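(* Let $X$ be the real Banach space $\ell_p$ with $p=3$ or $p=3/2$, and let $\mathcal{B}_1(X)$ be the set of all bounded linear operators $T:X\to X$ with $\|T\|\le 1$. Then all topologies $\tau$ on $\mathcal{B}_1(X)$ with $\mathtt{WOT}\subseteq\tau\subseteq\mathtt{SOT}^*$ are similar (i.e. any two such topologies are similar).
   Context: Two topologies on a set are called similar if they have the same dense sets (equivalently, the same sets with empty interior). For a net $(T_i)$ and $T$ in $\mathcal{B}(X)$ (bounded operators on $X$): $T_i\to T$ in $\mathtt{WOT}$ iff $T_ix\to Tx$ weakly for all $x\in X$; $T_i\to T$ in $\mathtt{SOT}^*$ iff $T_ix\to Tx$ in norm for all $x\in X$ and $T_i^*x^*\to T^*x^*$ in norm for all $x^*\in X^*$. On $\mathcal{B}_1(X)$ one considers the induced topologies. *)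

(* Defs.v *)
From HB Require Import structures.
From mathcomp Require Import all_boot all_order all_algebra.
From mathcomp Require Import all_classical all_reals all_analysis.

Set Implicit Arguments.
Unset Strict Implicit.
Unset Printing Implicit Defensive.

Import Order.TTheory GRing.Theory Num.Theory.
Import numFieldNormedType.Exports.

Local Open Scope classical_set_scope.
Local Open Scope ring_scope.

Section EllP.
Context (R : realType) (p : \bar R) (p1 : (1 <= p)%E).

(* Every subset of [nat] is measurable and only the empty set is null for the
   counting measure, so no quotient is needed here, unlike for a general
   [L_p] space. *)
Definition ell : Type := LfunType (@counting nat R) p1.

HB.instance Definition _ := GRing.Lmodule.on ell.

Definition ell_norm (x : ell) : R :=
  fine ('N[@counting nat R]_p [EFin \o (x : nat -> R)])%E.

Lemma ell_normD (x y : ell) : ell_norm (x + y) <= ell_norm x + ell_norm y.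
Proof. exact: ler_LnormD. Qed.

Lemma ell_normZ (a : R) (x : ell) : ell_norm (a *: x) = `|a| * ell_norm x.
Proof.
rewrite /ell_norm -[RHS]/(fine (`|a|%:E) * _) -fineM//.
  by congr fine; exact: LnormZ.
by rewrite -(finite_norm_fine x).
Qed.

Lemma ell_norm_eq0 (x : ell) : ell_norm x = 0 -> x = 0.
Proof.
move=> /fine_Lnormr_eq0 [N [_ N0 xN]]; apply/LfuneqP => k.
apply: contrapT => xk0; have Nk : N k.
  exact: (xN k (fun xk => xk0 (xk I))).
have {N0} : @counting nat R N = 0%E := N0; rewrite /counting; case: ifPn => [/asboolP Nfin|//] [] /eqP.
by rewrite pnatr_eq0 finmap.cardfs_eq0 => /eqP /(fset_set_set0 Nfin) N0; rewrite N0 in Nk.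
Qed.

HB.instance Definition _ :=
  Lmodule_isNormed.Build R ell ell_normD ell_normZ ell_norm_eq0.

End EllP.

Lemma ell_normE (R : realType) (p : R) (p1 : (1 <= p%:E)%E) (x : ell p1) :
  (`|x|%:E = (\sum_(k <oo) (`|x k| `^ p)%:E) `^ p^-1)%E.
Proof.
rewrite -[`|x|]/(ell_norm x) /ell_norm finite_norm_fine Lnorm_counting//.
by apply: lt_le_trans ltr01 _; rewrite -lee_fin.
Qed.

Section BoundedOperators.
Context (R : realType) (X Y : normedModType R).

Definition bounded_operator : {pred X -> Y} := fun T =>
  `[< linear T /\ exists M : R, forall x, `|T x| <= M * `|x| >].

Record bop := Bop { bop_fun :> X -> Y ; bopP : bop_fun \in bounded_operator }.

HB.instance Definition _ := [isSub for bop_fun].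
HB.instance Definition _ := [Choice of bop by <:].

Lemma bounded_operatorP (T : X -> Y) : T \in bounded_operator <->
  linear T /\ exists M : R, forall x, `|T x| <= M * `|x|.
Proof. by split=> [/asboolP|?]; last exact/asboolP. Qed.

Lemma bop_linear (T : bop) : linear T.
Proof. by have /bounded_operatorP[] := bopP T. Qed.

HB.instance Definition _ (T : bop) :=
  GRing.isLinear.Build R X Y *:%R T (bop_linear T).

Lemma bop_bounded (T : bop) : exists M : R, forall x, `|T x| <= M * `|x|.
Proof. by have /bounded_operatorP[] := bopP T. Qed.

Lemma bounded_operator_submod : submod_closed bounded_operator.
Proof.
split=> [|a S T].
  apply/bounded_operatorP; split=> [b x y|]; first by rewrite scaler0 addr0.
  by exists 0 => x; rewrite normr0 mul0r.
move=> /bounded_operatorP[Sl [M SM]] /bounded_operatorP[Tl [N TN]].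
apply/bounded_operatorP; split=> [b x y|].
  rewrite !fctE Sl Tl !scalerDr !scalerA (mulrC a b) -!addrA; congr (_ + _).
  by rewrite addrCA.
exists (`|a| * M + N) => x; rewrite !fctE (le_trans (ler_normD _ _))// mulrDl.
by rewrite lerD// normrZ -mulrA ler_wpM2l.
Qed.

HB.instance Definition _ :=
  GRing.isSubmodClosed.Build R (X -> Y) bounded_operator
    bounded_operator_submod.
HB.instance Definition _ := [SubChoice_isSubLmodule of bop by <:].

Definition opnorm (T : bop) : R :=
  sup [set `|T x| | x in [set x : X | `|x| <= 1]].

Lemma has_sup_opnorm (T : bop) :
  has_sup [set `|T x| | x in [set x : X | `|x| <= 1]].
Proof.
split; first by exists `|T 0|, 0 => //=; rewrite normr0.
have [M TM] := bop_bounded T; exists `|M| => _ [x /= x1 <-].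
rewrite (le_trans (TM x))// (le_trans (ler_norm _))// normrM normr_id.
by rewrite ler_piMr.
Qed.

Lemma opnorm_ge (T : bop) x : `|x| <= 1 -> `|T x| <= opnorm T.
Proof. by move=> x1; apply: sup_upper_bound (has_sup_opnorm T) _ _; exists x. Qed.

Lemma opnorm_le (T : bop) M : (forall x, `|x| <= 1 -> `|T x| <= M) ->
  opnorm T <= M.
Proof.
move=> TM; apply: ge_sup; first by have [] := has_sup_opnorm T.
by move=> _ [x /= x1 <-]; exact: TM.
Qed.

Lemma opnorm_ge0 (T : bop) : 0 <= opnorm T.
Proof. by rewrite (le_trans (normr_ge0 (T 0)))// opnorm_ge// normr0. Qed.

Lemma opnormP (T : bop) x : `|T x| <= opnorm T * `|x|.
Proof.
have [->|x0] := eqVneq x 0; first by rewrite linear0 !normr0 mulr0.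
have x0' : 0 < `|x| by rewrite normr_gt0.
rewrite -ler_pdivrMr//.
have -> : `|T x| / `|x| = `|T (`|x|^-1 *: x)|.
  by rewrite linearZ/= normrZ mulrC gtr0_norm// invr_gt0.
by apply: opnorm_ge; rewrite normrZ normrV ?unitfE ?gt_eqF// normr_id mulVf ?gt_eqF.
Qed.

Lemma opnormD (S T : bop) : opnorm (S + T) <= opnorm S + opnorm T.
Proof.
apply: opnorm_le => x x1.
by rewrite (le_trans (ler_normD _ _))// lerD// opnorm_ge.
Qed.

Lemma opnormZ (a : R) (T : bop) : opnorm (a *: T) = `|a| * opnorm T.
Proof.
have le_opnormZ b (S : bop) : opnorm (b *: S) <= `|b| * opnorm S.
  by apply: opnorm_le => x x1; rewrite [leLHS]normrZ ler_wpM2l// opnorm_ge.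
apply/eqP; rewrite eq_le le_opnormZ/=.
have [->|a0] := eqVneq a 0; first by rewrite normr0 mul0r opnorm_ge0.
rewrite -ler_pdivlMl ?normr_gt0// -normfV (le_trans _ (le_opnormZ _ _))//.
by rewrite scalerA mulVf// scale1r.
Qed.

Lemma opnorm_eq0 (T : bop) : opnorm T = 0 -> T = 0.
Proof.
move=> T0; apply/val_inj/funext => x; apply/eqP; rewrite -normr_le0.
by have := opnormP T x; rewrite T0 mul0r.
Qed.

HB.instance Definition _ :=
  Lmodule_isNormed.Build R bop opnormD opnormZ opnorm_eq0.

End BoundedOperators.

Definition dual (R : realType) (X : normedModType R) : Type := bop X R^o.
HB.instance Definition _ (R : realType) (X : normedModType R) :=
  NormedModule.on (dual X).

Section Adjoint.
Context (R : realType) (X : normedModType R) (T : bop X X) (f : dual X).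

Lemma adjoint_subproof : (f \o T : X -> R^o) \in @bounded_operator R X R^o.
Proof.
apply/bounded_operatorP; split=> [a x y|]; first by rewrite /= !linearP.
exists (opnorm f * opnorm T) => x; rewrite (le_trans (opnormP f _))// -mulrA.
by rewrite ler_wpM2l ?opnorm_ge0 ?opnormP.
Qed.

Definition adjoint : dual X := Bop adjoint_subproof.

End Adjoint.

Lemma cvg_initial (S : choiceType) (T : topologicalType) (f : S -> T)
    (F : set_system S) (s : S) : Filter F ->
  F --> (s : initial_topology f) <-> f @ F --> f s.
Proof.
move=> FF; split=> [Fs|fFs].
  by apply: cvg_comp Fs _; exact: (@initial_continuous _ _ f s).
move=> A /= [_ [[B Bop <-] Bfs sBA]]; apply: filterS sBA _.
by apply: fFs; exact: open_nbhs_nbhs.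
Qed.

Section OperatorTopologies.
Context (R : realType) (X : normedModType R).

(* These topologies are defined as initial topologies; [cvg_weak], [cvg_WOT] and
   [cvg_SOTstar] describe them by their convergence, with filters instead of
   nets. *)
Definition weak : Type := sup_topology (fun f : dual X =>
  Topological.on (initial_topology (f : X -> R^o))).
HB.instance Definition _ := Topological.on weak.

Definition WOT : Type := sup_topology (fun x : X =>
  Topological.on (initial_topology (fun T : bop X X => T x : weak))).
HB.instance Definition _ := Topological.on WOT.

Definition SOTstar : Type := sup_topology (fun i : X + dual X =>
  match i with
  | inl x => Topological.on (initial_topology (fun T : bop X X => T x))
  | inr f => Topological.on (initial_topology (fun T : bop X X => adjoint T f))
  end).
HB.instance Definition _ := Topological.on SOTstar.

Lemma cvg_weak (F : set_system X) (x : X) : Filter F ->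
  F --> (x : weak) <-> forall f : dual X, (f : X -> R^o) @ F --> f x.
Proof.
move=> FF; split=> [/cvg_sup Fx f|Fx].
  exact/(@cvg_initial _ _ (f : X -> R^o))/Fx.
by apply/cvg_sup => f; apply/(@cvg_initial _ _ (f : X -> R^o)); exact: Fx.
Qed.

Lemma cvg_WOT (F : set_system (bop X X)) (T : bop X X) : Filter F ->
  F --> (T : WOT) <->
  forall x : X, (fun S : bop X X => S x) @ F --> (T x : weak).
Proof.
move=> FF; split=> [/cvg_sup FT x|FT].
  exact/(@cvg_initial _ _ (fun S : bop X X => S x : weak))/FT.
apply/cvg_sup => x; apply/(@cvg_initial _ _ (fun S : bop X X => S x : weak)).
exact: FT.
Qed.

Lemma cvg_SOTstar (F : set_system (bop X X)) (T : bop X X) : Filter F ->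
  F --> (T : SOTstar) <->
  (forall x : X, (fun S : bop X X => S x) @ F --> T x) /\
  (forall f : dual X, (fun S : bop X X => adjoint S f) @ F --> adjoint T f).
Proof.
move=> FF; split=> [/cvg_sup FT|[FT FT']].
  split=> [x|f].
    exact/(@cvg_initial _ _ (fun S : bop X X => S x))/(FT (inl x)).
  exact/(@cvg_initial _ _ (fun S : bop X X => adjoint S f))/(FT (inr f)).
apply/cvg_sup => -[x|f].
  by apply/(@cvg_initial _ _ (fun S : bop X X => S x)); exact: FT.
by apply/(@cvg_initial _ _ (fun S : bop X X => adjoint S f)); exact: FT'.
Qed.

Definition B1 : Type := {T : bop X X | `|T| <= 1}.
HB.instance Definition _ := Choice.on B1.

Definition WOT1 : Topological B1 :=
  Topological.on (initial_topology (fun T : B1 => val T : WOT)).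

Definition SOTstar1 : Topological B1 :=
  Topological.on (initial_topology (fun T : B1 => val T : SOTstar)).

End OperatorTopologies.

Arguments WOT1 {R} X.
Arguments SOTstar1 {R} X.

(* [Topological S] is the class of all topologies on the type [S], as in
   [sup_topology]. *)
Definition coarser (S : Type) (s t : Topological S) : Prop :=
  @open (Topological.Pack s) `<=` @open (Topological.Pack t).

Definition similar_topologies (S : Type) (s t : Topological S) : Prop :=
  forall D : set S,
    @dense (Topological.Pack s) D <-> @dense (Topological.Pack t) D.

Lemma coarser_WOT1_SOTstar1 (R : realType) (X : normedModType R) :
  coarser (WOT1 X) (SOTstar1 X).
Proof.
move=> A [B Bop <-]; exists B => //; rewrite openE => T BT.
have TT : nbhs (T : SOTstar X) --> (T : WOT X).
  have /cvg_SOTstar[TT _] : nbhs (T : SOTstar X) --> (T : SOTstar X) by [].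
  apply/cvg_WOT => x; apply/cvg_weak => f.
  apply: cvg_comp (TT x) _; apply: bounded_linear_continuous.
  apply/linear_boundedP; near=> r => y; rewrite (le_trans (opnormP f y))//.
  by rewrite ler_wpM2r.
by apply: TT; exact: (@open_nbhs_nbhs (WOT X)).
Unshelve. all: by end_near. Qed.

(* Main.v *)
Require Import Defs.
From HB Require Import structures.
From mathcomp Require Import all_boot all_order all_algebra.
From mathcomp Require Import all_classical all_reals all_analysis.
From mathcomp Require Import ring lra.

Set Implicit Arguments.
Unset Strict Implicit.
Unset Printing Implicit Defensive.

Import Order.TTheory GRing.Theory Num.Theory.
Import numFieldNormedType.Exports.

Local Open Scope classical_set_scope.
Local Open Scope ring_scope.

(** Every nonempty SOT*-open set of contractions of l_p contains a nonempty WOT-open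
    one, for p = 3 and p = 3/2. Hence a set that is dense for WOT is dense for SOT*,
    and for all the topologies in between.

    Contractions are represented by their matrices. A strong* neighbourhood
    prescribes finitely many columns in l_p and, by duality, finitely many rows in
    l_q ([nbhs_SOTstar_star_close]), and a weak neighbourhood can prescribe finitely
    many entries ([entry_close_nbhs_WOT]). It is enough to make a small strong*
    perturbation after which weak proximity to the perturbed matrix b controls one
    given column or row. Since b stays frozen under perturbations inside a weak
    neighbourhood, this can be iterated ([freezableU], [star_close_entry_open]).
    Transposition exchanges the exponents 3 and 3/2, rows and columns
    ([contraction_transp]), so only columns are needed, for both exponents.

    Weak proximity controls the image of a vector h at which a contraction b nearly
    attains its norm: if c is close to b on many entries, then c h is close to b h
    on many coordinates, and norm at most 1 leaves no mass for the others. The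
    vectors at which b attains its norm must therefore be made to reach a given
    basis vector e_j. Both constructions start from a finite matrix of norm less
    than 1 ([truncation]) and add one new variable and one or two new rows.

    For exponents less than 2 ([frozen_column_lt_two]) one vector g is enough: the
    norm is nearly attained at g, with nonzero j-th entry, and the second difference
    of the norm along e_j is quadratic at g, which is less than the cost t^q of
    moving the image of e_j in new directions.

    For exponent 3 ([frozen_column_three]) a nearly maximal row f is chosen such that
    the truncation, with f added, is a contraction. Adding f itself would change
    column j. Instead, f and the new variable y are fed into a 2 x 2 contraction of
    l_3 whose first column is tiny and which attains its norm at two vectors that
    differ in the direction of its first variable ([kernel_le], [kernel_eq]). A
    contraction close to the result then behaves as if f were present, and the
    maximality of f leaves nothing for column j. *)

(** * Powers of absolute values *)

Section Powers.
Context {R : realType}.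
Implicit Types p q x y t a b : R.

Definition pw p x : R := `|x| `^ p.

Lemma pw_ge0 p x : 0 <= pw p x.
Proof. exact: powR_ge0. Qed.

Lemma pw_gt0 p x : x != 0 -> 0 < pw p x.
Proof. by move=> x0; rewrite powR_gt0 ?normr_gt0. Qed.

Lemma pw0 p : p != 0 -> pw p 0 = 0.
Proof. by move=> p0; rewrite /pw normr0 powR0. Qed.

Lemma pw1 p : pw p 1 = 1.
Proof. by rewrite /pw normr1 powR1. Qed.

Lemma pwN p x : pw p (- x) = pw p x.
Proof. by rewrite /pw normrN. Qed.

Lemma pwM p x y : pw p (x * y) = pw p x * pw p y.
Proof. by rewrite /pw normrM powRM. Qed.

Lemma pw3 x : pw 3 x = `|x| ^+ 3.
Proof. by rewrite /pw (powR_mulrn 3). Qed.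

Lemma ler_pw p x y : 0 <= p -> `|x| <= `|y| -> pw p x <= pw p y.
Proof. by move=> p0 xy; rewrite /pw ge0_ler_powR. Qed.

Lemma ler_pwE p x y : 0 < p -> (pw p x <= pw p y) = (`|x| <= `|y|).
Proof.
move=> p0; apply/idP/idP => [|xy]; last exact: ler_pw (ltW p0) xy.
by apply: contraTT; rewrite -!ltNge => yx; rewrite gt0_ltr_powR ?nnegrE.
Qed.

(** Young's inequality for [`|x| `^ (p - 1)] and [`|y|]: the convex function [pw p]
    lies above its tangent at [x]. *)
Lemma pw_tangent p x y : 1 < p ->
  pw p x - pw p y <= p * pw (p - 1) x * `|x - y|.
Proof.
move=> p1; have p0 : 0 < p by rewrite (lt_trans ltr01).
have pB1 : 0 < p - 1 by rewrite subr_gt0.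
pose q := p / (p - 1).
have q0 : 0 < q by rewrite divr_gt0.
have qp : q^-1 + p^-1 = 1.
  by rewrite /q invf_div mulrBl divff ?gt_eqF// mul1r subrK.
have := @conjugate_powR R (pw (p - 1) x) `|y| q p (pw_ge0 _ _) (normr_ge0 _) q0 p0 qp.
have -> : pw (p - 1) x `^ q = pw p x.
  by rewrite /pw -powRrM /q mulrC divfK// gt_eqF.
rewrite -[`|y| `^ p]/(pw p y) => Y.
have {Y} : p * (pw (p - 1) x * `|y|) <= (p - 1) * pw p x + pw p y.
  apply: le_trans (_ : p * (pw p x / q + pw p y / p) <= _).
    by rewrite ler_pM2l.
  rewrite mulrDr [X in _ + X]mulrC divfK ?gt_eqF// lerD2r /q invf_div.
  by rewrite mulrCA [p * _]mulrC divfK ?gt_eqF// mulrC.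
have E : pw p x = pw (p - 1) x * `|x|.
  by rewrite mulrC /pw mulr_powRB1.
have : pw (p - 1) x * (`|x| - `|y|) <= pw (p - 1) x * `|x - y|.
  by apply: ler_wpM2l; [exact: pw_ge0 | rewrite lerB_dist].
rewrite -(ler_pM2l p0) E; lra.
Qed.

Lemma pw_convex p x y a b : 1 < p -> 0 <= a -> 0 <= b -> a + b = 1 ->
  pw p (a * x + b * y) <= a * pw p x + b * pw p y.
Proof.
move=> p1 a0 b0 ab.
have a1 : a <= 1 by rewrite -ab lerDl.
have -> : b = 1 - a by rewrite -ab addrAC subrr add0r.
have norm_in (z : R) : `|z| \in (`[0, +oo[%classic : set R).
  by rewrite inE/= in_itv/= normr_ge0.
have := convex_powR (ltW p1) (Itv01 a0 a1) (norm_in x) (norm_in y).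
rewrite !convRE /unstable.onem /=.
apply: le_trans; rewrite -[leRHS]/((a * `|x| + (1 - a) * `|y|) `^ p).
rewrite ge0_ler_powR ?nnegrE// ?addr_ge0 ?mulr_ge0 ?subr_ge0//.
  by rewrite (le_trans ler01)// ltW.
rewrite (le_trans (ler_normD _ _))// !normrM ger0_norm// [`|1 - a|]ger0_norm//.
by rewrite subr_ge0.
Qed.

Lemma pw_mid p x y : 1 < p -> pw p x <= (pw p (x + y) + pw p (x - y)) / 2.
Proof.
move=> p1; rewrite [leRHS]mulrC mulrDr.
have {1}-> : x = 2^-1 * (x + y) + 2^-1 * (x - y) by field.
by apply: pw_convex => //; field.
Qed.

Lemma pwD p x y : 1 < p -> pw p (x + y) <= pw p 2 * (pw p x + pw p y).
Proof.
move=> p1; have -> : x + y = 2 * (2^-1 * x + 2^-1 * y) by field.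
rewrite pwM ler_wpM2l ?pw_ge0//.
apply: le_trans (_ : 2^-1 * pw p x + 2^-1 * pw p y <= _).
  by apply: pw_convex => //; field.
have := pw_ge0 p x; have := pw_ge0 p y; lra.
Qed.

Lemma pwB p x y : 1 < p -> pw p (x - y) <= pw p 2 * (pw p x + pw p y).
Proof. by move=> p1; rewrite (le_trans (pwD _ _ p1))// pwN. Qed.

Lemma pw_root p c : 0 < p -> 0 < c -> exists2 w, 0 < w & pw p w = c.
Proof.
move=> p0 c0; exists (c `^ p^-1); first exact: powR_gt0.
by rewrite /pw ger0_norm ?powR_ge0// -powRrM mulVf ?gt_eqF// powRr1// ltW.
Qed.

Lemma pw_small p e : 0 < p -> 0 < e -> exists2 d, 0 < d &
  forall x, `|x| <= d -> pw p x <= e.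
Proof.
move=> p0 e0; have [d d0 <-] := pw_root p0 e0; exists d => // x xd.
by apply: ler_pw; rewrite ?(gtr0_norm d0)// ltW.
Qed.

End Powers.

(** * Matrices that are contractions of l_p *)

Section Contractions.
Context {R : realType}.
Implicit Types (p q r e d : R) (a b c : nat -> nat -> R) (h : nat -> R).

Definition psum p n h := \sum_(0 <= j < n) pw p (h j).

Definition mx_app c n h i := \sum_(0 <= j < n) c i j * h j.

Definition contraction p c :=
  forall m n h, psum p m (mx_app c n h) <= psum p n h.

Definition transp c : nat -> nat -> R := fun i j => c j i.

Lemma psum_ge0 p n h : 0 <= psum p n h.
Proof. by apply: sumr_ge0 => i _; exact: pw_ge0. Qed.

Lemma psum_le p m n h : (m <= n)%N -> psum p m h <= psum p n h.
Proof.
move=> mn; rewrite /psum (big_cat_nat (leq0n m) mn)//= lerDl.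
by apply: sumr_ge0 => i _; exact: pw_ge0.
Qed.

Lemma psum_cat p m n h :
  psum p (m + n) h = psum p m h + psum p n (fun i => h (m + i)%N).
Proof.
rewrite /psum (big_cat_nat (leq0n m) (leq_addr n m))/=; congr (_ + _).
rewrite -[X in \sum_(X <= _ < _) _]addn0 addnC (addnC m n) big_addn addnK.
by apply: eq_bigr => i _; rewrite addnC.
Qed.

Lemma psumS p n h : psum p n.+1 h = psum p n h + pw p (h n).
Proof. by rewrite /psum big_nat_recr. Qed.

Lemma psum_recl p n h :
  psum p n.+1 h = pw p (h 0%N) + psum p n (fun i => h i.+1).
Proof. by rewrite /psum big_nat_recl. Qed.

Lemma psum1 p h : psum p 1 h = pw p (h 0%N).
Proof. by rewrite /psum big_nat1. Qed.

Lemma eq_mx_app c n h h' i : (forall j, (j < n)%N -> h j = h' j) ->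
  mx_app c n h i = mx_app c n h' i.
Proof. by move=> hh; apply: eq_big_nat => j /andP[_ /hh ->]. Qed.

Lemma mx_appS c n h i : mx_app c n.+1 h i = mx_app c n h i + c i n * h n.
Proof. by rewrite /mx_app big_nat_recr. Qed.

Lemma mx_appD c n h h' i :
  mx_app c n (fun j => h j + h' j) i = mx_app c n h i + mx_app c n h' i.
Proof. by rewrite /mx_app -big_split/=; apply: eq_bigr => j _; rewrite mulrDr. Qed.

Lemma mx_appZ c n t h i : mx_app c n (fun j => t * h j) i = t * mx_app c n h i.
Proof. by rewrite /mx_app mulr_sumr; apply: eq_bigr => j _; rewrite mulrCA. Qed.

Lemma pw_le_psum p j n h : (j < n)%N -> pw p (h j) <= psum p n h.
Proof.
move=> jn; apply: le_trans (psum_le p h jn).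
by rewrite /psum big_nat_recr//= lerDr; exact: psum_ge0.
Qed.

Lemma eq_psum p n h h' : (forall i, (i < n)%N -> h i = h' i) ->
  psum p n h = psum p n h'.
Proof. by move=> hh; apply: eq_big_nat => i /andP[_ /hh ->]. Qed.

Lemma ler_psum p p' n h h' : (forall i, (i < n)%N -> pw p (h i) <= pw p' (h' i)) ->
  psum p n h <= psum p' n h'.
Proof. by move=> hh; apply: ler_sum_nat => i /andP[_ /hh]. Qed.

Lemma psumZ p n t h : psum p n (fun i => t * h i) = pw p t * psum p n h.
Proof.
by rewrite /psum mulr_sumr; apply: eq_bigr => i _; rewrite pwM.
Qed.

Lemma psumD p n h h' : 1 < p ->
  psum p n (fun i => h i + h' i) <= pw p 2 * (psum p n h + psum p n h').
Proof.
move=> p1; rewrite /psum -big_split/= mulr_sumr.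
by apply: ler_sum => i _; exact: pwD.
Qed.

Lemma psumB p n h h' : 1 < p ->
  psum p n (fun i => h i - h' i) <= pw p 2 * (psum p n h + psum p n h').
Proof.
move=> p1; rewrite /psum -big_split/= mulr_sumr.
by apply: ler_sum => i _; exact: pwB.
Qed.

Lemma psum_midpoint p n h h' : 1 < p ->
  2 * psum p n h <=
    psum p n (fun i => h i + h' i) + psum p n (fun i => h i - h' i).
Proof.
move=> p1; rewrite /psum -big_split/= mulr_sumr; apply: ler_sum => i _.
have := pw_mid (h i) (h' i) p1; lra.
Qed.

Definition unit_vec j : nat -> R := fun i => (i == j)%:R.

Lemma sum_unit_vec (F : nat -> R) j n : (j < n)%N ->
  \sum_(0 <= i < n) F i * unit_vec j i = F j.
Proof.
move=> jn; rewrite (bigD1_seq j)/= ?mem_index_iota ?iota_uniq//.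
rewrite /unit_vec eqxx mulr1 big1 ?addr0// => i /negbTE ->; exact: mulr0.
Qed.

Lemma psum_unit_vec p j n : p != 0 -> (j < n)%N -> psum p n (unit_vec j) = 1.
Proof.
move=> p0 jn; rewrite -(@sum_unit_vec (fun _ => 1) j n)//.
apply: eq_bigr => i _; rewrite /unit_vec mul1r.
by case: eqP => _; rewrite ?pw1// pw0.
Qed.

Lemma psum_add_unit_vec p j n t h : (j < n)%N ->
  psum p n (fun i => h i + t * unit_vec j i) =
    psum p n h + (pw p (h j + t) - pw p (h j)).
Proof.
move=> jn; rewrite -(@sum_unit_vec (fun i => pw p (h i + t) - pw p (h i)) j n)//.
rewrite /psum -big_split/=; apply: eq_bigr => i _; rewrite /unit_vec.
by case: eqP => _; rewrite ?mulr1 ?mulr0 ?addr0// subrKC.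
Qed.

Lemma contraction_col p c j m : p != 0 -> contraction p c ->
  psum p m (c^~ j) <= 1.
Proof.
move=> p0 cc; rewrite -(@psum_unit_vec p j j.+1)//.
by rewrite (le_trans _ (cc m j.+1 (unit_vec j)))// (@eq_psum p m (mx_app c j.+1 (unit_vec j)) (c^~ j))// => i _;
  exact: sum_unit_vec.
Qed.

Lemma contraction_entry p c i j : 0 < p -> contraction p c -> `|c i j| <= 1.
Proof.
move=> p0 cc; rewrite -[leRHS]normr1 -(ler_pwE _ _ p0) pw1.
rewrite (le_trans (pw_le_psum p (c^~ j) (ltnSn i)))//.
by apply: contraction_col => //; rewrite gt_eqF.
Qed.

(** [\sum_i pw q (g i)] is the pairing of [g] with its duality image [x], to which
    Young's inequality and the contractivity of [c] on [x] apply. *)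
Lemma contraction_transp p q c : 1 < p -> 1 < q -> p^-1 + q^-1 = 1 ->
  contraction p c -> contraction q (transp c).
Proof.
move=> p1 q1 pq cc m n h.
have p0 : 0 < p by rewrite (lt_trans ltr01).
have q0 : 0 < q by rewrite (lt_trans ltr01).
set g := mx_app (transp c) n h.
pose x i := Num.sg (g i) * `|g i| `^ (q - 1).
have norm_x i : `|x i| = `|g i| `^ (q - 1).
  rewrite /x normrM normr_sg [X in _ * X]ger0_norm ?powR_ge0//.
  by case: eqVneq => [->|_]; rewrite ?mul1r// mul0r normr0 powR0// gt_eqF// subr_gt0.
have xE i : pw p (x i) = pw q (g i).
  rewrite /pw norm_x -powRrM; congr (_ `^ _).
  have : q + p = q * p.
    by rewrite -[RHS]mulr1 -pq; field; rewrite !gt_eqF.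
  by rewrite mulrBl mul1r => <-; rewrite addrK.
have gx i : g i * x i = pw q (g i).
  by rewrite /x mulrA (mulrC (g i)) -normrEsg /pw mulr_powRB1.
have E : psum q m g = \sum_(0 <= j < n) h j * mx_app c m x j.
  rewrite /psum; under eq_bigr do rewrite -gx /g /mx_app mulr_suml.
  rewrite exchange_big_nat/=; apply: eq_bigr => j _; rewrite mulr_sumr.
  by apply: eq_bigr => i _; rewrite /transp; ring.
have : psum q m g <= psum q n h / q + psum p n (mx_app c m x) / p.
  rewrite {1}E /psum !mulr_suml -big_split/=; apply: ler_sum => j _.
  rewrite (le_trans (ler_norm _))// normrM.
  by apply: conjugate_powR => //; rewrite addrC.
have : psum p n (mx_app c m x) <= psum q m g.
  by rewrite (le_trans (cc n m x))// (_ : psum p m x = psum q m g)//;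
     apply: eq_bigr.
have -> : p^-1 = 1 - q^-1 by rewrite -pq addrK.
move=> cx le_g.
have : psum q m g * q^-1 <= psum q n h * q^-1.
  have : psum p n (mx_app c m x) * (1 - q^-1) <= psum q m g * (1 - q^-1).
    by rewrite ler_wpM2r// subr_ge0 invf_le1// ltW.
  lra.
by rewrite ler_pM2r// invr_gt0.
Qed.

End Contractions.

(** * Proximity of matrices *)

Section Proximity.
Context {R : realType}.
Implicit Types (p q r e d : R) (a b c : nat -> nat -> R) (h : nat -> R).

Definition conjugate_exponents p q := [/\ 1 < p, 1 < q & p^-1 + q^-1 = 1].

Definition entry_close m d b c :=
  forall i j, (i < m)%N -> (j < m)%N -> `|c i j - b i j| < d.

Definition col_close p e j b c :=
  forall m, psum p m (fun i => c i j - b i j) <= e.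

Definition star_close p q n e b c := forall j, (j < n)%N ->
  col_close p e j b c /\ col_close q e j (transp b) (transp c).

Definition supported m b := forall i j, (m <= i)%N || (m <= j)%N -> b i j = 0.

Lemma conjugate_exponentsC p q :
  conjugate_exponents p q -> conjugate_exponents q p.
Proof. by case=> p1 q1 pq; split=> //; rewrite addrC. Qed.

Lemma col_close_sym p e j b c : col_close p e j b c -> col_close p e j c b.
Proof.
move=> bc m; rewrite (le_trans _ (bc m))// le_eqVlt; apply/orP; left.
by apply/eqP/eq_bigr => i _; rewrite -pwN opprB.
Qed.

Lemma col_closeW p e e' j b c : e <= e' -> col_close p e j b c ->
  col_close p e' j b c.
Proof. by move=> ee bc m; exact: le_trans (bc m) ee. Qed.

Lemma col_close_trans p e e' j a b c : 1 < p -> col_close p e j a b ->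
  col_close p e' j b c -> col_close p (pw p 2 * (e' + e)) j a c.
Proof.
move=> p1 ab bc m.
rewrite (@eq_psum _ _ _ _ (fun i => (c i j - b i j) + (b i j - a i j))); last first.
  by move=> i _; ring.
by rewrite (le_trans (psumD _ _ _ p1))// ler_wpM2l ?pw_ge0// lerD.
Qed.

Lemma star_closeC p q n e b c : star_close p q n e b c ->
  star_close q p n e (transp b) (transp c).
Proof. by move=> bc j /bc[]. Qed.

Lemma star_closeW p q n n' e e' b c : (n <= n')%N -> e' <= e ->
  star_close p q n' e' b c -> star_close p q n e b c.
Proof.
move=> nn ee bc j jn; have [] := bc j (leq_trans jn nn).
by split; exact: (@col_closeW _ e').
Qed.

Lemma star_close_trans p q n e e' a b c : 1 < p -> 1 < q -> 0 <= e -> 0 <= e' ->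
  star_close p q n e a b -> star_close p q n e' b c ->
  star_close p q n ((pw p 2 + pw q 2) * (e' + e)) a c.
Proof.
move=> p1 q1 e0 e0' ab bc j jn; have [abp abq] := ab j jn.
have [bcp bcq] := bc j jn; split.
  apply: col_closeW (col_close_trans p1 abp bcp).
  by rewrite ler_wpM2r ?addr_ge0// lerDl pw_ge0.
apply: col_closeW (col_close_trans q1 abq bcq).
by rewrite ler_wpM2r ?addr_ge0// lerDr pw_ge0.
Qed.

Lemma star_close_entry p q d m : 0 < p -> 0 < d ->
  exists2 e, 0 < e & forall b c, star_close p q m e b c -> entry_close m d b c.
Proof.
move=> p0 d0; exists (pw p d / 2).
  by rewrite divr_gt0// pw_gt0// gt_eqF.
move=> b c bc i j im jm; have [/(_ m) bcj _] := bc j jm.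
have := le_trans (pw_le_psum p (fun i => c i j - b i j) im) bcj.
apply: contraTT; rewrite -leNgt -ltNge => dbc.
apply: lt_le_trans (_ : pw p d <= _).
  have : 0 < pw p d by rewrite pw_gt0// gt_eqF.
  lra.
by apply: ler_pw; [exact: ltW | rewrite gtr0_norm//; exact: dbc].
Qed.

(** Entrywise proximity controls the finitely many rows that meet the support of
    [b]; beyond them the difference of the columns is a tail of the column of
    [c]. *)
Lemma col_close_tail p e e' m d j b c : 0 <= p -> supported m b ->
  entry_close m d b c -> (j < m)%N -> psum p m (fun=> d) <= e ->
  (forall n, psum p n (fun i => c (m + i)%N j) <= e') ->
  col_close p (e + e') j b c.
Proof.
move=> p0 bm bc jm de ce n.
rewrite (le_trans (psum_le p _ (leq_addl m n)))// psum_cat lerD//.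
  apply: le_trans de; apply: ler_psum => i im; apply: ler_pw => //.
  by rewrite (le_trans (ltW (bc i j im jm)))// ler_norm.
rewrite (le_trans _ (ce n))//; apply: ler_psum => i _.
by rewrite bm ?leq_addr// subr0.
Qed.

Lemma psum_tail p e B h : 0 < e -> (forall n, psum p n h <= B) ->
  exists m, forall m', (m <= m')%N -> forall n,
    psum p n (fun i => h (m' + i)%N) <= e.
Proof.
move=> e0 hB; pose S := [set psum p n h | n in [set: nat]].
have supS : has_sup S.
  split; first by exists (psum p 0 h), 0%N.
  by exists B => _ [n _ <-].
have [_ [m _ <-] Sm] := sup_adherent e0 supS.
exists m => m' mm' n.
have : psum p (m' + n) h <= sup S.
  by apply: sup_upper_bound => //; exists (m' + n)%N.
have : psum p m h <= psum p m' h by exact: psum_le.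
rewrite psum_cat; lra.
Qed.

Lemma psum_const_small p e m : 0 < p -> 0 < e ->
  exists2 d, 0 < d & forall d', 0 <= d' <= d -> psum p m (fun=> d') <= e.
Proof.
move=> p0 e0; have em0 : 0 < e / m.+1%:R by rewrite divr_gt0.
have [d d0 dP] := pw_small p0 em0; exists d => // d' /andP[d'0 d'd].
rewrite /psum sumr_const_nat subn0 -mulr_natl.
apply: le_trans (_ : m.+1%:R * (e / m.+1%:R) <= _).
  by rewrite ler_pM ?pw_ge0 ?ler_nat// dP// ger0_norm.
by rewrite mulrC divfK// pnatr_eq0.
Qed.

Lemma uniform_bound (P : nat -> nat -> Prop) n :
  (forall j, exists m, forall m', (m <= m')%N -> P j m') ->
  exists m, forall j, (j < n)%N -> forall m', (m <= m')%N -> P j m'.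
Proof.
move=> Pm; elim: n => [|n [m mP]]; first by exists 0%N.
have [k kP] := Pm n; exists (maxn m k) => j; rewrite ltnS leq_eqVlt.
move=> /predU1P[->|jn] m'; rewrite geq_max => /andP[mm' km'].
  exact: kP.
exact: mP.
Qed.

(** The error term is homogeneous in [h], since functionals on the whole space
    will be compared. *)
Lemma psum_perturb p t m n : 1 < p -> 0 < t -> exists2 d, 0 < d &
  forall b c, (forall i j, (i < m)%N -> (j < n)%N -> `|b i j| <= 1) ->
  (forall i j, (i < m)%N -> (j < n)%N -> `|c i j - b i j| < d) ->
  forall h, psum p m (mx_app b n h) <=
    psum p m (mx_app c n h) + t * psum p n h.
Proof.
move=> p1 t0; have p0 : 0 < p by rewrite (lt_trans ltr01).
have pB0 : 0 <= p - 1 by rewrite subr_ge0 ltW.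
pose C := m%:R * (p * pw p n%:R); have C0 : 0 <= C.
  by rewrite !mulr_ge0 ?ler0n ?pw_ge0// ltW.
have [d d_gt0 dE] : exists2 d, 0 < d & (C + 1) * d = t.
  exists (t / (C + 1)); first by rewrite divr_gt0// ltr_wpDl.
  by rewrite mulrC divfK// gt_eqF// ltr_wpDl.
exists d => // b c b1 bc h; have d0 := ltW d_gt0.
pose N := psum p n h `^ p^-1.
have N0 : 0 <= N by exact: powR_ge0.
have NE : pw p N = psum p n h.
  rewrite /pw ger0_norm// -powRrM mulVf ?gt_eqF// powRr1//; exact: psum_ge0.
have hN j : (j < n)%N -> `|h j| <= N.
  by move=> jn; rewrite -(ger0_norm N0) -(ler_pwE _ _ p0) NE pw_le_psum.
have app_le (g : nat -> R) (k : R) : (forall j, (j < n)%N -> `|g j| <= k) ->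
    `|\sum_(0 <= j < n) g j * h j| <= k * (n%:R * N).
  move=> gk; rewrite (le_trans (ler_norm_sum _ _ _))//.
  apply: le_trans (_ : \sum_(0 <= j < n) k * N <= _).
    by apply: ler_sum_nat => j /andP[_ jn]; rewrite normrM ler_pM ?gk ?hN.
  by rewrite sumr_const_nat subn0 -[X in X <= _]mulr_natl mulrCA.
have K i : (i < m)%N -> pw p (mx_app b n h i) <=
    pw p (mx_app c n h i) + p * d * (pw p n%:R * psum p n h).
  move=> im; rewrite -lerBlDl (le_trans (pw_tangent _ _ p1))//.
  have -> : pw p n%:R * psum p n h = pw (p - 1) (n%:R * N) * (n%:R * N).
    by rewrite -NE -pwM [RHS]mulrC /pw (ger0_norm (mulr_ge0 (ler0n _ n) N0)) mulr_powRB1// mulr_ge0.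
  rewrite -!mulrA ler_pM2l// mulrCA ler_pM ?pw_ge0//.
    apply: ler_pw => //; rewrite [leRHS]ger0_norm ?mulr_ge0//.
    by rewrite -[leRHS]mul1r; apply: app_le => j jn; exact: b1.
  rewrite /mx_app -sumrB; under eq_bigr do rewrite -mulrBl.
  by apply: app_le => j jn; rewrite distrC ltW// bc.
apply: le_trans (_ : psum p m (mx_app c n h) +
  m%:R * (p * d * (pw p n%:R * psum p n h)) <= _).
  rewrite mulr_natl -[X in _ *+ X]subn0 -sumr_const_nat -big_split/=.
  by apply: ler_sum_nat => i /andP[_ /K].
rewrite lerD2l -dE -[leRHS]mulrA; have -> : m%:R * (p * d * (pw p n%:R * psum p n h)) =
   C * (d * psum p n h) by rewrite /C; ring.
by rewrite ler_wpM2r ?mulr_ge0 ?psum_ge0// lerDl.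
Qed.

(** Strong*-dense are the contractions [b] at which weak proximity controls the
    [j]-th column. By transposition, the same notion for the conjugate exponent
    controls the rows. *)
Definition frozen_column_dense (p q : R) := forall a n j e,
  contraction p a -> 0 < e ->
  exists b m d, [/\ contraction p b, supported m b, star_close p q n e a b,
    0 < d & forall c, contraction p c -> entry_close m d b c ->
      col_close p e j b c].

End Proximity.

(** * Truncation *)

Section Truncation.
Context {R : realType}.
Implicit Types (p q r e d t : R) (a b c : nat -> nat -> R) (h : nat -> R).

Lemma mx_app_supported b m n h i : supported m b -> (m <= n)%N ->
  mx_app b n h i = mx_app b m h i.
Proof.
move=> bm mn; rewrite /mx_app (big_cat_nat (leq0n m) mn)/=.
rewrite [X in _ + X]big_nat_cond [X in _ + X]big1 ?addr0// => j.
by move=> /andP[/andP[mj _] _]; rewrite bm ?mul0r// mj orbT.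
Qed.

Lemma contraction_supported p m b : p != 0 -> supported m b ->
  (forall h, psum p m (mx_app b m h) <= psum p m h) -> contraction p b.
Proof.
move=> p0 bm b_contr m' n h.
pose h' j := if (j < n)%N then h j else 0.
have hh' i : mx_app b n h i = mx_app b m h' i.
  rewrite -(@mx_app_supported b m (n + m) h' i bm) ?leq_addl// /mx_app.
  rewrite [RHS](big_cat_nat (leq0n n) (leq_addr m n))/=.
  rewrite [X in _ = _ + X]big_nat_cond [X in _ = _ + X]big1 ?addr0.
    by apply: eq_big_nat => j /andP[_ jn]; rewrite /h' jn.
  by move=> j /andP[/andP[nj _] _]; rewrite /h' ltnNge nj mulr0.
have psum_h' : psum p m h' <= psum p n h.
  apply: le_trans (psum_le p h' (leq_addl n m)) _; rewrite psum_cat.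
  rewrite (@eq_psum _ _ n h' h); last by move=> i ilt; rewrite /h' ilt.
  rewrite [X in _ + X]big1 ?addr0// => i _.
  by rewrite /h' ltnNge leq_addr/= pw0.
apply: le_trans psum_h'; apply: le_trans (b_contr h').
apply: le_trans (psum_le p _ (leq_addl m m')) _; rewrite psum_cat.
rewrite [X in _ + X]big1 ?addr0 => [|i _]; last first.
  by rewrite hh' /mx_app big1 ?pw0// => j _; rewrite bm ?mul0r// leq_addr.
by apply: ler_psum => i _; rewrite hh'.
Qed.

Definition truncate t m a : nat -> nat -> R :=
  fun i j => if (i < m)%N && (j < m)%N then t * a i j else 0.

Lemma transp_truncate t m a : transp (truncate t m a) = truncate t m (transp a).
Proof. by apply/funext => i; apply/funext => j; rewrite /transp/truncate andbC. Qed.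

Lemma col_close_truncate p e t m j a : p != 0 -> contraction p a -> (j < m)%N ->
  pw p (1 - t) <= e / 2 ->
  (forall n, psum p n (fun i => a (m + i)%N j) <= e / 2) ->
  col_close p e j a (truncate t m a).
Proof.
move=> p0 ac jm te ae n; rewrite (le_trans (psum_le p _ (leq_addl m n)))//.
rewrite psum_cat [e]splitr lerD//.
  apply: le_trans te; rewrite -[leRHS]mulr1.
  apply: le_trans (_ : pw p (1 - t) * psum p m (a^~ j) <= _); last first.
    by rewrite ler_wpM2l ?pw_ge0// contraction_col.
  rewrite -psumZ; apply: ler_psum => i im.
  by rewrite /truncate im jm/= -pwN opprB mulrBl mul1r.
apply: le_trans (ae n); apply: ler_psum => i _.
by rewrite /truncate ltnNge leq_addr/= sub0r pwN.
Qed.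

(** Columns are [p]-summable and, by duality, rows are [q]-summable, so cutting off
    changes them little; a scalar factor less than 1 makes the deficit
    [psum p m h - psum p m (mx_app b m h)] comparable to [psum p m h]. *)
Lemma truncation p q a n e : conjugate_exponents p q -> contraction p a ->
  0 < e -> exists m (k : R) b, [/\ (n <= m)%N, 0 <= k < 1, supported m b,
    star_close p q n e a b &
    forall h, psum p m (mx_app b m h) <= k * psum p m h].
Proof.
move=> [p1 q1 pq] ac e0.
have p0 : 0 < p by rewrite (lt_trans ltr01).
have q0 : 0 < q by rewrite (lt_trans ltr01).
have pN0 : p != 0 by rewrite gt_eqF.
have qN0 : q != 0 by rewrite gt_eqF.
have e20 : 0 < e / 2 by rewrite divr_gt0.
have ac' := contraction_transp p1 q1 pq ac.
have [m1 m1P] := @uniform_bound (fun j m => forall n,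
    psum p n (fun i => a (m + i)%N j) <= e / 2) n
  (fun j => psum_tail e20 (fun k => contraction_col j k pN0 ac)).
have [m2 m2P] := @uniform_bound (fun j m => forall n,
    psum q n (fun i => transp a (m + i)%N j) <= e / 2) n
  (fun j => psum_tail e20 (fun k => contraction_col j k qN0 ac')).
have [d1 d10 d1P] := pw_small p0 e20.
have [d2 d20 d2P] := pw_small q0 e20.
pose s := Num.min 1 (Num.min d1 d2).
have s0 : 0 < s by rewrite !lt_min ltr01 d10.
have [s1 sd1 sd2] : [/\ s <= 1, s <= d1 & s <= d2] by rewrite !ge_min !lexx !orbT.
pose t := 1 - s; have tE : 1 - t = s by rewrite /t opprB addrC subrK.
have t0 : 0 <= t by rewrite subr_ge0.
pose m := maxn n (maxn m1 m2).
have nm : (n <= m)%N by exact: leq_maxl.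
have m1m : (m1 <= m)%N by rewrite /m !leq_max leqnn !orbT.
have m2m : (m2 <= m)%N by rewrite /m !leq_max leqnn !orbT.
exists m, (pw p t), (truncate t m a); split=> //.
- rewrite pw_ge0/= -(pw1 p).
  apply: gt0_ltr_powR => //; rewrite normr1 ger0_norm// /t ltrBlDr ltrDl.
  exact: s0.
- by move=> i j; rewrite /truncate (leqNgt m i) (leqNgt m j) -negb_and => /negbTE ->.
- move=> j jn; have jm := leq_trans jn nm; split.
    by apply: col_close_truncate => //; [rewrite tE d1P// gtr0_norm|exact: m1P].
  rewrite transp_truncate; apply: col_close_truncate => //.
    by rewrite tE d2P// gtr0_norm.
  exact: m2P.
- move=> h; apply: le_trans (_ : pw p t * psum p m (mx_app a m h) <= _).
    rewrite -psumZ; apply: ler_psum => i im; rewrite /mx_app mulr_sumr.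
    rewrite le_eqVlt; apply/orP; left; apply/eqP; congr pw.
    by apply: eq_big_nat => j /andP[_ jm]; rewrite /truncate im jm/= mulrA.
  by rewrite ler_wpM2l ?pw_ge0.
Qed.

End Truncation.

(** * Freezing a column of a contraction of l_3 *)

Section ColumnThree.
Context {R : realType}.
Implicit Types (e d k : R) (a b c : nat -> nat -> R) (f h : nat -> R).

(** The matrix with rows [(t, v)] and [(- t, v)] has a small first column, is a
    contraction of the plane l_3, and attains its norm at two vectors whose
    difference is a multiple of the first basis vector. The left side grows like
    [x ^+ 2] near [x = 0] and the right side like [`|x| ^+ 3], so the norm is not
    attained at [x = 0]; this needs an exponent greater than 2. *)
Lemma kernel_le (t v x y : R) : 0 <= t -> t <= 2^-1 -> 0 <= v ->
  v ^+ 3 * (2 + 32 * t ^+ 6) = 1 ->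
  `|t * x + v * y| ^+ 3 + `|v * y - t * x| ^+ 3 <= `|x| ^+ 3 + `|y| ^+ 3.
Proof.
move=> t0 t2 v0 vE.
wlog x0 : x / 0 <= x.
  move=> H; have [/H//|/ltW x0] := leP 0 x.
  have {H} := H (- x); rewrite oppr_ge0 normrN mulrN => /(_ x0).
  by rewrite opprK addrC [- _ + _]addrC [v * y + _]addrC.
wlog y0 : y / 0 <= y.
  move=> H; have [/H//|/ltW y0] := leP 0 y.
  have {H} := H (- y); rewrite oppr_ge0 normrN mulrN => /(_ y0).
  have -> : t * x + v * y = - (- (v * y) - t * x) by ring.
  have -> : v * y - t * x = - (t * x - v * y) by ring.
  by rewrite !normrN addrC.
have tx0 : 0 <= t * x by rewrite mulr_ge0.
have vy0 : 0 <= v * y by rewrite mulr_ge0.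
rewrite (ger0_norm x0) (ger0_norm y0) ger0_norm ?addr_ge0//.
have [vt|vt] := leP (t * x) (v * y).
  rewrite ger0_norm ?subr_ge0// -subr_ge0.
  (* the discriminant condition on v makes 4 t^2 v y a double root in x *)
  have -> : x ^+ 3 + y ^+ 3 - ((t * x + v * y) ^+ 3 + (v * y - t * x) ^+ 3) =
      (x - 4 * t ^+ 2 * v * y) ^+ 2 * (x + 2 * t ^+ 2 * v * y).
    have -> : y ^+ 3 = v ^+ 3 * (2 + 32 * t ^+ 6) * y ^+ 3 by rewrite vE mul1r.
    ring.
  by rewrite mulr_ge0 ?sqr_ge0// addr_ge0// !mulr_ge0 ?exprn_ge0.
rewrite ltr0_norm ?subr_lt0// opprB.
have y30 : 0 <= y ^+ 3 by rewrite exprn_ge0.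
apply: le_trans (_ : (2 * (t * x)) ^+ 3 <= _).
  rewrite -subr_ge0.
  have -> : (2 * (t * x)) ^+ 3 - ((t * x + v * y) ^+ 3 + (t * x - v * y) ^+ 3) =
    6 * (t * x) * (t * x - v * y) * (t * x + v * y) by ring.
  have txvy : 0 <= t * x - v * y by rewrite subr_ge0 ltW.
  by do !apply: mulr_ge0 => //; exact: addr_ge0.
apply: le_trans (_ : x ^+ 3 <= _); last by rewrite lerDl.
rewrite lerXn2r ?nnegrE ?mulr_ge0// mulrA ler_piMl//.
lra.
Qed.

Lemma kernel_eq (t v y : R) : 0 <= t -> t <= 2^-1 -> 0 <= v ->
  v ^+ 3 * (2 + 32 * t ^+ 6) = 1 -> let x := 4 * t ^+ 2 * v * y in
  `|t * x + v * y| ^+ 3 + `|v * y - t * x| ^+ 3 = `|x| ^+ 3 + `|y| ^+ 3.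
Proof.
move=> t0 t2 v0 vE x.
have -> : t * x + v * y = (1 + 4 * t ^+ 3) * v * y by rewrite /x; ring.
have -> : v * y - t * x = (1 - 4 * t ^+ 3) * v * y by rewrite /x; ring.
have t31 : 4 * t ^+ 3 <= 1.
  have : t ^+ 3 <= 2^-1 ^+ 3 by rewrite lerXn2r ?nnegrE.
  have -> : (2^-1 : R) ^+ 3 = 8^-1 by field.
  lra.
have N (c : R) : 0 <= c -> `|c * v * y| = c * v * `|y|.
  by move=> c0; rewrite normrM ger0_norm// mulr_ge0.
rewrite /x !N ?subr_ge0 ?addr_ge0 ?mulr_ge0 ?exprn_ge0//.
have E : v ^+ 3 * 2 = 1 - v ^+ 3 * (32 * t ^+ 6) by lra.
set Y := `|y|.
have -> : ((1 + 4 * t ^+ 3) * v * Y) ^+ 3 + ((1 - 4 * t ^+ 3) * v * Y) ^+ 3 =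
  (v ^+ 3 * 2 + 96 * t ^+ 6 * v ^+ 3) * Y ^+ 3 by ring.
rewrite E; ring.
Qed.

(** Hoelder's inequality. With [X] the sum on the left and [S], [T] those on the
    right, summing [3 u^2 w <= 2 u^3 + w^3] at [u = X |g_i|] and [w = S |y_i|]
    gives [X^3 S <= S^3 T]. *)
Lemma hoelder_three n (g y : nat -> R) : 0 < psum 3 n g ->
  `|\sum_(0 <= i < n) g i * `|g i| * y i| ^+ 3 <=
    psum 3 n g ^+ 2 * psum 3 n y.
Proof.
set S := psum 3 n g => S0; set T := psum 3 n y.
pose X := \sum_(0 <= i < n) `|g i| ^+ 2 * `|y i|.
have XE : X = \sum_(0 <= i < n) `|g i| ^+ 2 * `|y i| by [].
have X0 : 0 <= X by apply: sumr_ge0 => i _; rewrite mulr_ge0// exprn_ge0.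
apply: le_trans (_ : X ^+ 3 <= _).
  rewrite lerXn2r ?nnegrE//; apply: le_trans (ler_norm_sum _ _ _) _.
  by apply: ler_sum => i _; rewrite !normrM normr_id expr2.
rewrite -(ler_pM2r S0).
have : \sum_(0 <= i < n) 3 * (X * `|g i|) ^+ 2 * (S * `|y i|) <=
    \sum_(0 <= i < n) (2 * (X ^+ 3 * pw 3 (g i)) + S ^+ 3 * pw 3 (y i)).
  apply: ler_sum => i _; rewrite !pw3 -subr_ge0.
  set u := `|g i|; set w := `|y i|.
  have -> : 2 * (X ^+ 3 * u ^+ 3) + S ^+ 3 * w ^+ 3 -
     3 * (X * u) ^+ 2 * (S * w) = (X * u - S * w) ^+ 2 * (2 * (X * u) + S * w).
    by ring.
  have Xu : 0 <= X * u by rewrite mulr_ge0 ?normr_ge0.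
  have Sw : 0 <= S * w by rewrite mulr_ge0 ?normr_ge0 ?(ltW S0).
  by rewrite mulr_ge0 ?sqr_ge0// addr_ge0// mulr_ge0.
rewrite big_split/= -!mulr_sumr -/(psum 3 n g) -/(psum 3 n y) -/S -/T.
have -> : \sum_(0 <= i < n) 3 * (X * `|g i|) ^+ 2 * (S * `|y i|) =
    3 * (X ^+ 3 * S).
  have -> : 3 * (X ^+ 3 * S) = 3 * X ^+ 2 * S * X by ring.
  by rewrite [Z in _ = _ * Z]XE mulr_sumr; apply: eq_bigr => i _; ring.
have -> : S ^+ 2 * T * S = S ^+ 3 * T by ring.
lra.
Qed.

(** Pairing a family of functionals with the duality image of its value at [j]
    gives a single functional, to which the bound [k] applies. This is what makes
    a nearly maximal functional leave no room for further rows. *)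
Lemma dominated_family m j (D : (nat -> R) -> R) k :
  (j < m)%N ->
  (forall f, (forall h, `|\sum_(0 <= l < m) f l * h l| ^+ 3 <= D h) ->
    `|f j| ^+ 3 <= k) ->
  forall n t (F : nat -> nat -> R), 0 < t ->
  (forall h, psum 3 n (mx_app F m h) <= t * D h) ->
  psum 3 n (F^~ j) <= t * k.
Proof.
move=> jm kP n t F t0 FD; set S := psum 3 n (F^~ j).
have [S0|S0] := leP S 0.
  rewrite (le_trans S0)// mulr_ge0 ?(ltW t0)//.
  have := kP (fun=> 0); rewrite normr0 expr0n; apply=> h.
  rewrite big1 ?normr0 ?expr0n// => [|i _]; last by rewrite mul0r.
  by have := le_trans (psum_ge0 _ _ _) (FD h); rewrite pmulr_rge0.
pose chi l := \sum_(0 <= i < n) F i j * `|F i j| * F i l.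
have chij : chi j = S.
  apply: eq_bigr => i _; rewrite pw3 -mulrA [_ * F i j]mulrC mulrA -expr2.
  by rewrite -real_normK ?num_real// -exprSr.
have chiE h : \sum_(0 <= l < m) chi l * h l =
    \sum_(0 <= i < n) F i j * `|F i j| * mx_app F m h i.
  rewrite /chi; under eq_bigr do rewrite mulr_suml.
  rewrite exchange_big_nat/=; apply: eq_bigr => i _; rewrite mulr_sumr.
  by apply: eq_bigr => l _; rewrite mulrA.
have S2t0 : 0 < S ^+ 2 * t by rewrite mulr_gt0 ?exprn_gt0.
have [w w0 wE] := @pw_root R 3 _ (ltr0Sn _ 2) S2t0.
have {}wE : w ^+ 3 = S ^+ 2 * t by rewrite -wE pw3 gtr0_norm.
have : `|chi j / w| ^+ 3 <= k.
  apply: (kP (fun l => chi l / w)) => h.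
  have -> : \sum_(0 <= l < m) chi l / w * h l =
      (\sum_(0 <= l < m) chi l * h l) / w.
    by rewrite mulr_suml; apply: eq_bigr => l _; rewrite mulrAC.
  rewrite normrM normfV (gtr0_norm w0) exprMn exprVn wE ler_pdivrMr//.
  rewrite chiE (le_trans (hoelder_three _ S0))// -/S.
  have -> : D h * (S ^+ 2 * t) = S ^+ 2 * (t * D h) by ring.
  by rewrite ler_pM2l ?exprn_gt0//; exact: FD.
rewrite chij normrM normfV !gtr0_norm// exprMn exprVn wE ler_pdivrMr//.
have -> : k * (S ^+ 2 * t) = S ^+ 2 * (t * k) by ring.
by rewrite exprSr ler_pM2l ?exprn_gt0.
Qed.

(** When [|f h|^3 + |a0 h|^3 <= |h|^3], the matrix [a0] with the extra row [f] is a
    contraction; here the plane contraction above is applied to the output of this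
    row and to a new variable, of index [m]. *)
Definition feed_kernel m t v a0 (f : nat -> R) : nat -> nat -> R :=
  let row s l := if (l < m)%N then s * f l else if l == m then v else 0 in
  fun i l => if (i < m)%N then a0 i l else if i == m then row t l
    else if i == m.+1 then row (- t) l else 0.

Section FeedKernel.
Context (m : nat) (t v : R) (a0 : nat -> nat -> R) (f : nat -> R).
Context (a0m : supported m a0).
Let b := feed_kernel m t v a0 f.

Lemma supported_feed_kernel : supported m.+2 b.
Proof.
move=> i l /orP[mi|ml]; rewrite /b /feed_kernel.
  by rewrite ltnNge (ltnW (ltnW mi))/= (gtn_eqF (ltnW mi)) (gtn_eqF mi).
have ml' := ltnW (ltnW ml).
rewrite a0m ?ml' ?orbT// [(l < m)%N]ltnNge ml'/= (gtn_eqF (ltnW ml)).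
by do !case: ifP.
Qed.

Lemma psum_feed_kernel h : psum 3 m.+2 (mx_app b m.+2 h) =
  psum 3 m (mx_app a0 m h) +
  (`|t * (\sum_(0 <= l < m) f l * h l) + v * h m| ^+ 3 +
   `|v * h m - t * (\sum_(0 <= l < m) f l * h l)| ^+ 3).
Proof.
have bm1 i : b i m.+1 = 0.
  rewrite /b /feed_kernel a0m ?leqnSn ?orbT// [(m.+1 < m)%N]ltnNge leqnSn/= (gtn_eqF (ltnSn m)).
  by rewrite !if_same.
have app_row s : \sum_(0 <= l < m) (if (l < m)%N then s * f l else
    if l == m then v else 0) * h l = s * \sum_(0 <= l < m) f l * h l.
  rewrite mulr_sumr; apply: eq_big_nat => l' /andP[_ ->]; rewrite mulrA//.
have app i : mx_app b m.+2 h i = mx_app b m h i + b i m * h m.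
  by rewrite !mx_appS bm1 mul0r addr0.
rewrite !psumS !pw3 -addrA; congr (_ + (_ + _)).
- apply: eq_psum => i im; rewrite app /mx_app /b /feed_kernel im.
  by rewrite a0m ?leqnn ?orbT// mul0r addr0.
- by rewrite app /mx_app /b /feed_kernel ltnn eqxx app_row.
- rewrite app /mx_app /b /feed_kernel [(m.+1 < m)%N]ltnNge leqnSn/= (gtn_eqF (ltnSn m)) !eqxx ltnn.
  by rewrite app_row mulNr addrC.
Qed.

Context (t0 : 0 <= t) (t2 : t <= 2^-1) (v0 : 0 <= v).
Context (vE : v ^+ 3 * (2 + 32 * t ^+ 6) = 1).
Context (fD : forall h, `|\sum_(0 <= l < m) f l * h l| ^+ 3 <=
  psum 3 m h - psum 3 m (mx_app a0 m h)).

Lemma contraction_feed_kernel : contraction 3 b.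
Proof.
apply: (contraction_supported _ supported_feed_kernel) => // h.
rewrite psum_feed_kernel.
apply: le_trans (lerD (lexx _) (kernel_le _ _ t0 t2 v0 vE)) _.
rewrite !psumS (pw3 (h m)).
have := fD h; have := pw_ge0 3 (h m.+1); lra.
Qed.

Lemma star_close_feed_kernel q n : q != 0 -> (n <= m)%N ->
  (forall l, (l < m)%N -> `|f l| <= 1) ->
  star_close 3 q n (2 * t ^+ 3) a0 b.
Proof.
move=> q0 nm f1 l ln; have lm := leq_trans ln nm; split=> k; last first.
  rewrite /psum big1 ?mulr_ge0 ?exprn_ge0// => i _.
  rewrite /transp /b /feed_kernel lm.
  by rewrite subrr pw0.
have row_le (s : R) : `|s| = t -> pw 3 (s * f l) <= t ^+ 3.
  move=> <-; rewrite pwM !pw3 ler_piMr ?exprn_ge0// exprn_ile1//; exact: f1.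
rewrite (le_trans (psum_le 3 _ (leq_addl m.+2 k)))// psum_cat !psumS.
rewrite [X in _ + X]big1 ?addr0 => [|i _]; last first.
  have mi : (m <= m.+2 + i)%N := leq_trans (ltnW (leqnSn _)) (leq_addr _ _).
  by rewrite supported_feed_kernel ?leq_addr// a0m ?mi// subr0 pw0.
rewrite [psum _ _ _]big_nat_cond [X in X + _ + _]big1 ?add0r => [|i]; last first.
  by rewrite andbT => /andP[_ im]; rewrite /b /feed_kernel im subrr pw0.
have -> : b m l - a0 m l = t * f l.
  by rewrite a0m ?leqnn// subr0 /b /feed_kernel ltnn eqxx lm.
have -> : b m.+1 l - a0 m.+1 l = - t * f l.
  rewrite a0m ?leqnSn// subr0 /b /feed_kernel lm.
  by rewrite [(m.+1 < m)%N]ltnNge leqnSn/= (gtn_eqF (ltnSn m)) eqxx.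
by rewrite mulr2n mulrDl mul1r lerD// row_le// ?normrN ger0_norm.
Qed.

End FeedKernel.

(** Let [D h] be the deficit [|h|^3 - |a0 h|^3] of a truncation [a0], and [f] a
    functional with [|f h|^3 <= D h] whose value at [j] is nearly maximal. Let [c]
    be entrywise close to [feed_kernel m t v a0 f], and let [psi] collect the rows
    of [c] beyond the support of that matrix. The kernel attains its norm at the
    vectors [(h, y)] and [(h, - y)] with [y] proportional to [f h], and averaging
    the contractivity of [c] over both gives, up to a small error,
    [|f h|^3 + |psi h|^3 <= D h]. By maximality of [f] the [j]-th column of [psi] is
    small. *)
Lemma frozen_column_three (q : R) : conjugate_exponents 3 q ->
  frozen_column_dense 3 q.
Proof.
move=> pq a n j e ac e0; have [p1 q1 _] := pq.
have q0 : q != 0 by rewrite gt_eqF// (lt_trans ltr01).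
pose C := pw 3 2 + pw q 2; have C0 : 0 < C.
  by rewrite ltr_pwDl ?pw_ge0// pw_gt0.
pose e1 := e / (2 * C); have e10 : 0 < e1 by rewrite divr_gt0// mulr_gt0.
have [m [k [a0 [nm /andP[k0 k1] a0m a_a0 a0k]]]] :=
  truncation (maxn n j.+1) pq ac e10.
have jm : (j < m)%N := leq_trans (leq_maxr _ _) nm.
have {}nm : (n <= m)%N := leq_trans (leq_maxl _ _) nm.
pose D h := psum 3 m h - psum 3 m (mx_app a0 m h).
have Dk h : (1 - k) * psum 3 m h <= D h by have := a0k h; rewrite /D; lra.
have k10 : 0 < 1 - k by rewrite subr_gt0.
have D_le h : D h <= psum 3 m h.
  by have := psum_ge0 3 m (mx_app a0 m h); rewrite /D; lra.
have D0 h : 0 <= D h.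
  by rewrite (le_trans _ (Dk h))// mulr_ge0 ?psum_ge0// ltW.
have dominated_le1 f : (forall h, `|\sum_(0 <= l < m) f l * h l| ^+ 3 <= D h) ->
    forall l, (l < m)%N -> `|f l| ^+ 3 <= 1.
  move=> fD l lm; have := fD (unit_vec l); rewrite sum_unit_vec// => /le_trans.
  by apply; rewrite (le_trans (D_le _))// psum_unit_vec.
(* f nearly attains the supremum at j over the functionals dominated by D *)
pose V := [set `|f j| ^+ 3 | f in
  [set f : nat -> R | forall h, `|\sum_(0 <= l < m) f l * h l| ^+ 3 <= D h]].
have V1 : ubound V 1 by move=> _ [f /= fD <-]; exact: dominated_le1.
have supV : has_sup V.
  split; last by exists 1.
  exists (`|0 : R| ^+ 3); exists (fun=> 0) => //= h.
  by rewrite big1 ?normr0 ?expr0n// => l _; rewrite mul0r.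
pose s := sup V; have s1 : s <= 1 by apply: ge_sup => //; case: supV.
have sP f : (forall h, `|\sum_(0 <= l < m) f l * h l| ^+ 3 <= D h) ->
    `|f j| ^+ 3 <= s.
  by move=> fD; apply: sup_upper_bound => //; exists f.
pose eta := e / 3; have eta0 : 0 < eta by rewrite divr_gt0.
have [_ [f /= fD <-] fs] := sup_adherent eta0 supV.
rewrite -/s in fs.
have f1 l : (l < m)%N -> `|f l| <= 1.
  move=> lm; have fl := dominated_le1 f fD l lm.
  by rewrite -(@ler_pXn2r _ 3) ?nnegrE ?expr1n.
pose t := Num.min 2^-1 (e1 / 2).
have [t0 t2 te] : [/\ 0 < t, t <= 2^-1 & 2 * t ^+ 3 <= e1].
  have t0 : 0 < t by rewrite lt_min invr_gt0 ltr0n divr_gt0.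
  have t2 : t <= 2^-1 by rewrite ge_min lexx.
  have te : t <= e1 / 2 by rewrite ge_min lexx orbT.
  have t1 : t <= 1 by lra.
  split=> //; have : t ^+ 3 <= t.
    by rewrite exprS ler_piMr ?exprn_ile1// ltW.
  lra.
have [v v0 vE] : exists2 v, 0 < v & v ^+ 3 * (2 + 32 * t ^+ 6) = 1.
  have c0 : 0 < (2 + 32 * t ^+ 6) by rewrite addr_gt0// mulr_gt0 ?exprn_gt0.
  have [v v0 vc] := @pw_root R 3 (2 + 32 * t ^+ 6)^-1 (ltr0Sn _ 2) ltac:(by rewrite invr_gt0).
  exists v => //; have <- : pw 3 v = v ^+ 3 by rewrite pw3 gtr0_norm.
  by rewrite vc mulVf// gt_eqF.
pose b := feed_kernel m t v a0 f.
have bm : supported m.+2 b by exact: supported_feed_kernel.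
have bc : contraction 3 b.
  by apply: contraction_feed_kernel => //; exact: ltW.
pose x0 := 4 * t ^+ 2 * v.
have x00 : 0 < x0 by rewrite !mulr_gt0 ?exprn_gt0.
pose tau := eta * (1 - k) / (1 + x0^-1 ^+ 3).
have tau0 : 0 < tau.
  by rewrite divr_gt0 ?mulr_gt0// ltr_pwDl// exprn_ge0// invr_ge0 ltW.
have [d1 d10 d1P] := psum_perturb m.+2 m.+2 p1 tau0.
have [d2 d20 d2P] := @psum_const_small R 3 eta m.+2 (ltr0Sn _ 2) eta0.
pose d := Num.min d1 d2.
have d0 : 0 < d by rewrite lt_min d10.
exists b, m.+2, d; split=> //.
  have -> : e = C * (e1 + e1) by rewrite /e1; field; rewrite gt_eqF.
  apply: (@star_close_trans _ _ _ _ _ _ _ a0) => //; [exact: ltW.. | |].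
    exact: star_closeW (leq_maxl _ _) (lexx _) a_a0.
  by apply: star_closeW (leqnn _) te _; apply: star_close_feed_kernel => //; exact: ltW.
move=> c cc bcd.
have [dd1 dd2] : d <= d1 /\ d <= d2 by rewrite !ge_min !lexx orbT.
have jm2 : (j < m.+2)%N by rewrite (ltn_trans jm)// (ltn_trans (ltnSn _)).
have tail N h : psum 3 N (fun i => mx_app c m.+2 h (m.+2 + i)%N) <=
    psum 3 m.+2 h - psum 3 m.+2 (mx_app b m.+2 h) + tau * psum 3 m.+2 h.
  have := cc (m.+2 + N)%N m.+2 h; rewrite psum_cat.
  have : psum 3 m.+2 (mx_app b m.+2 h) <=
      psum 3 m.+2 (mx_app c m.+2 h) + tau * psum 3 m.+2 h.
    apply: d1P => i l im lm; last exact: lt_le_trans (bcd i l im lm) dd1.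
    exact: contraction_entry bc.
  lra.
have e3 : eta + (eta + eta) = e by rewrite /eta; field.
rewrite -e3; apply: (col_close_tail _ bm bcd jm2) => // [|N].
  by apply: d2P; rewrite dd2 ltW.
(* f is listed as row 0, before the rows of c beyond those of b *)
pose F i l := if i is i'.+1 then c (m.+2 + i')%N l else f l.
have FD h : psum 3 N.+1 (mx_app F m h) <= (1 + eta) * D h.
  pose phi := \sum_(0 <= l < m) f l * h l.
  pose y := phi / x0.
  pose g (s : R) i := if (i < m)%N then h i else if i == m then s else 0.
  have gh s' i : (i < m)%N -> g s' i = h i by rewrite /g => ->.
  have gm s' : g s' m = s' by rewrite /g ltnn eqxx.
  have gm1 s' : g s' m.+1 = 0.
    by rewrite /g [(m.+1 < m)%N]ltnNge leqnSn/= (gtn_eqF (ltnSn m)).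
  have psum_g s' : psum 3 m.+2 (g s') = psum 3 m h + `|s'| ^+ 3.
    rewrite !psumS gm gm1 pw0// addr0 pw3; congr (_ + _).
    by apply: eq_psum => i; exact: gh.
  have psum_bg s' : s' = y \/ s' = - y -> psum 3 m.+2 (mx_app b m.+2 (g s')) =
      psum 3 m (mx_app a0 m h) + (`|phi| ^+ 3 + `|y| ^+ 3).
    move=> s'y; rewrite psum_feed_kernel// gm; congr (_ + _).
      by apply: eq_psum => i _; apply: eq_mx_app => l; exact: gh.
    have -> : \sum_(0 <= l < m) f l * g s' l = phi.
      by apply: eq_big_nat => l /andP[_ lm]; rewrite gh.
    have phiE : phi = 4 * t ^+ 2 * v * y by rewrite /y mulrC divfK// gt_eqF.
    have <- : `|t * phi + v * y| ^+ 3 + `|v * y - t * phi| ^+ 3 =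
        `|phi| ^+ 3 + `|y| ^+ 3.
      by rewrite phiE; apply: kernel_eq => //; exact: ltW.
    case: s'y => -> //; rewrite ?normrN.
    have -> : t * phi + v * - y = - (v * y - t * phi) by ring.
    have -> : v * - y - t * phi = - (t * phi + v * y) by ring.
    by rewrite !normrN addrC.
  have app_g s' i : mx_app c m.+2 (g s') i = mx_app c m h i + c i m * s'.
    rewrite !mx_appS gm gm1 mulr0 addr0; congr (_ + _).
    by apply: eq_mx_app => l; exact: gh.
  pose psi i := mx_app c m h (m.+2 + i)%N.
  pose psi' i := c (m.+2 + i)%N m * y.
  have tail_le s' : s' = y \/ s' = - y ->
      psum 3 N (fun i => psi i + c (m.+2 + i)%N m * s') <=
      D h - `|phi| ^+ 3 + tau * (psum 3 m h + `|y| ^+ 3).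
    move=> s'y; have := tail N (g s'); rewrite psum_bg// psum_g.
    have -> : `|s'| = `|y| by case: s'y => ->; rewrite ?normrN.
    rewrite (@eq_psum _ _ _ (fun i => mx_app c m.+2 (g s') (m.+2 + i)%N)
      (fun i => psi i + c (m.+2 + i)%N m * s')) => [|i _]; last exact: app_g.
    rewrite /D; lra.
  have := tail_le y (or_introl erefl); have := tail_le (- y) (or_intror erefl).
  rewrite (@eq_psum _ _ _ (fun i => psi i + _ * - y) (fun i => psi i - psi' i))
    => [|i _]; last by rewrite mulrN.
  have := psum_midpoint N psi psi' p1.
  have : tau * (psum 3 m h + `|y| ^+ 3) <= eta * D h.
    apply: le_trans (_ : eta * ((1 - k) * psum 3 m h) <= _); last first.
      by rewrite ler_pM2l.
    rewrite /tau mulrAC ler_pdivrMr; last by rewrite ltr_pwDl// exprn_ge0// invr_ge0 ltW.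
    rewrite -!mulrA !ler_pM2l// mulrDr mulr1 lerD2l /y normrM normfV (gtr0_norm x00).
    rewrite exprMn ler_wpM2r ?exprn_ge0 ?invr_ge0 ?(ltW x00)//.
    exact: le_trans (fD h) (D_le h).
  rewrite psum_recl pw3 -/phi -/psi -/psi'.
  rewrite -[mx_app F m h 0]/phi -[X in psum 3 N X]/psi; lra.
have := dominated_family jm sP (ltr_pwDl ltr01 (ltW eta0)) FD.
rewrite psum_recl pw3 /=.
have : eta * s <= eta by rewrite ler_piMr// ltW.
lra.
Qed.

End ColumnThree.

(** * Freezing a column of a contraction of l_q, q < 2 *)

Section ColumnLessThanTwo.
Context {R : realType}.
Implicit Types (q e d k : R) (a b c : nat -> nat -> R) (f h : nat -> R).

Lemma powR_bernoulli (r y : R) : 0 < r -> r < 1 -> 0 <= y ->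
  y `^ r <= 1 + r * (y - 1).
Proof.
move=> r0 r1 y0; have s0 : 0 < 1 - r by rewrite subr_gt0.
have := @conjugate_powR R (y `^ r) 1 r^-1 (1 - r)^-1 (powR_ge0 _ _) ler01.
rewrite !invr_gt0 !invrK mulr1 powR1 mul1r subrKC -powRrM mulfV ?gt_eqF// powRr1//.
move=> /(_ r0 s0 erefl) /le_trans; apply; lra.
Qed.

Lemma pw_second_difference q t : 1 < q -> q < 2 -> 0 <= t -> t <= 1 ->
  pw q (1 + t) + pw q (1 - t) <= 2 + 2 * t ^+ 2.
Proof.
move=> q1 q2 t0 t1.
have B y : 0 <= y -> pw q y <= y * (1 + (q - 1) * (y - 1)).
  move=> y0; rewrite /pw ger0_norm// -mulr_powRB1//; last lra.
  by rewrite ler_wpM2l// powR_bernoulli//; lra.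
have := B (1 + t) ltac:(lra); have := B (1 - t) ltac:(lra).
have : (q - 1) * t ^+ 2 <= t ^+ 2 by rewrite ler_piMl ?sqr_ge0//; lra.
nra.
Qed.

(** The matrix [a0] with one more row, which combines the [j]-th variable with a
    new variable, of index [m]. *)
Definition feed_entry m s v a0 j : nat -> nat -> R := fun i l =>
  if (i < m)%N then a0 i l else
  if i == m then (if l == j then s else if l == m then v else 0) else 0.

Section FeedEntry.
Context (q : R) (m j : nat) (s v : R) (a0 : nat -> nat -> R).
Context (a0m : supported m a0) (jm : (j < m)%N).
Let b := feed_entry m s v a0 j.

Lemma supported_feed_entry : supported m.+1 b.
Proof.
move=> i l /orP[mi|ml]; rewrite /b /feed_entry.
  by rewrite ltnNge (ltnW mi)/= (gtn_eqF mi).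
rewrite a0m ?(ltnW ml) ?orbT// (gtn_eqF ml) (gtn_eqF (ltn_trans jm ml)).
by rewrite !if_same.
Qed.

Lemma psum_feed_entry h : psum q m.+1 (mx_app b m.+1 h) =
  psum q m (mx_app a0 m h) + pw q (s * h j + v * h m).
Proof.
rewrite psumS; congr (_ + pw _ _).
  apply: eq_psum => i im; rewrite mx_appS /mx_app /b /feed_entry im.
  by rewrite a0m ?leqnn ?orbT// mul0r addr0.
rewrite mx_appS /mx_app /b /feed_entry ltnn !eqxx (gtn_eqF jm); congr (_ + _).
rewrite -(@sum_unit_vec _ (fun l => s * h l) j m jm).
apply: eq_big_nat => l /andP[_ lm]; rewrite /unit_vec (ltn_eqF lm).
by case: eqP => _; rewrite ?mulr1// mulr0 mul0r.
Qed.

Lemma star_close_feed_entry p n : p != 0 -> q != 0 -> (n <= m)%N ->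
  star_close q p n (pw q s) a0 b.
Proof.
move=> p0 q0 nm l ln; have lm := leq_trans ln nm; split=> k; last first.
  rewrite /psum big1 ?pw_ge0// => i _.
  by rewrite /transp /b /feed_entry lm subrr pw0.
rewrite (le_trans (psum_le q _ (leq_addl m.+1 k)))// psum_cat !psumS.
rewrite [X in _ + X]big1 ?addr0 => [|i _]; last first.
  have mi : (m <= m.+1 + i)%N := leq_trans (leqnSn _) (leq_addr _ _).
  by rewrite supported_feed_entry ?leq_addr// a0m ?mi// subr0 pw0.
rewrite [psum _ _ _]big_nat_cond [X in X + _]big1 ?add0r => [|i]; last first.
  by rewrite andbT => /andP[_ im]; rewrite /b /feed_entry im subrr pw0.
rewrite a0m ?leqnn// subr0 /b /feed_entry ltnn eqxx (ltn_eqF lm).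
by case: eqP => // _; rewrite pw0// pw_ge0.
Qed.

End FeedEntry.

(** Convexity makes [s * x + v * y] a weighted mean of multiples of [x] and [y]; the
    weights are proportional to [k] and [pw q z], with [z] so large that [s] is
    small. *)
Lemma entry_kernel q k d : 1 < q -> 0 < k -> k <= 1 -> 0 < d ->
  exists s v z : R, [/\ `|s| <= d,
    (forall x y, pw q (s * x + v * y) <= k * pw q x + pw q y) &
    pw q (s + v * z) = k + pw q z].
Proof.
move=> q1 k0 k1 d0; have q0 : 0 < q by rewrite (lt_trans ltr01).
have qB0 : 0 < q - 1 by rewrite subr_gt0.
pose B := d^-1 + 2; have B2 : 2 <= B by rewrite lerDr invr_ge0 ltW.
have B0 : 0 < B by lra.
have [y y0 yB] := @pw_root R (q - 1) B qB0 B0.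
pose w := pw q y; have wE : w = y * B.
  by rewrite /w -yB /pw gtr0_norm// mulr_powRB1// ltW.
have y1 : 1 <= y.
  rewrite leNgt; apply/negP => yl1.
  have : pw (q - 1) y <= 1.
    apply: le_trans (_ : pw (q - 1) 1 <= _); last by rewrite pw1.
    by apply: ler_pw; rewrite ?normr1 ?gtr0_norm// ltW.
  rewrite yB; lra.
have w2 : 2 <= w by rewrite wE; nra.
have w0 : 0 < w by lra.
have wk0 : 0 < w - k by lra.
have [z z0 zE] := pw_root q0 wk0.
exists (k / w * y), ((w - k) / w * (y / z)), z; split.
- rewrite gtr0_norm ?mulr_gt0 ?invr_gt0// wE.
  have -> : k / (y * B) * y = k / B by field; rewrite !gt_eqF.
  rewrite ler_pdivrMr// (le_trans k1)// /B mulrDr divff ?gt_eqF// lerDl.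
  by rewrite mulr_ge0// ltW.
- move=> x x'.
  have -> : k / w * y * x + (w - k) / w * (y / z) * x' =
    k / w * (y * x) + (w - k) / w * (y / z * x') by ring.
  apply: le_trans (@pw_convex _ _ _ _ _ _ q1 _ _ _) _.
  + by rewrite divr_ge0// ltW.
  + by rewrite divr_ge0// ltW.
  + by rewrite -mulrDl subrKC divff// gt_eqF.
  rewrite !pwM -/w.
  have -> : pw q z^-1 = (w - k)^-1.
    have wkN0 : w - k != 0 by rewrite gt_eqF.
    by apply: (mulIf wkN0); rewrite -{1}zE -pwM !mulVf ?pw1// gt_eqF.
  have -> : (w - k) / w * (w / (w - k) * pw q x') = pw q x'.
    by field; rewrite !gt_eqF.
  have -> : k / w * (w * pw q x) = k * pw q x by field; rewrite gt_eqF.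
  by [].
- have -> : k / w * y + (w - k) / w * (y / z) * z = y.
    by field; rewrite !gt_eqF.
  by rewrite zE subrKC.
Qed.

(** Let [k] be the infimum of the deficit [D] of a truncation over the vectors with
    [j]-th entry 1, nearly attained at [h0]. By [entry_kernel] the matrix
    [b = feed_entry m s v a0 j] is still a contraction, and it nearly attains its
    norm at the vector [g0] extending [h0] by [z]. Moving [g0] by [t] and by [- t]
    along the [j]-th basis vector changes the mean of the [q]-th powers of the norm
    by [O(t ^+ 2)] only. A column of mass [u] beyond the support of [b], in a
    contraction close to [b], would cost [pw q t * u] there, and
    [t ^+ 2 / pw q t] is small because [q < 2]. *)
Lemma frozen_column_lt_two q p : conjugate_exponents q p -> q < 2 ->
  frozen_column_dense q p.
Proof.
move=> qp q2 a n j e ac e0; have [q1 p1 _] := qp.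
have q_gt0 : 0 < q by rewrite (lt_trans ltr01).
have q0 : q != 0 by rewrite gt_eqF.
have p0 : p != 0 by rewrite gt_eqF// (lt_trans ltr01).
pose C := pw q 2 + pw p 2; have C0 : 0 < C.
  by rewrite ltr_pwDl ?pw_ge0// pw_gt0.
pose e1 := e / (2 * C); have e10 : 0 < e1 by rewrite divr_gt0// mulr_gt0.
have [m [kk [a0 [nm /andP[kk0 kk1] a0m a_a0 a0kk]]]] :=
  truncation (maxn n j.+1) qp ac e10.
have jm : (j < m)%N := leq_trans (leq_maxr _ _) nm.
have {}nm : (n <= m)%N := leq_trans (leq_maxl _ _) nm.
pose D h := psum q m h - psum q m (mx_app a0 m h).
have Dk h : (1 - kk) * psum q m h <= D h by have := a0kk h; rewrite /D; lra.
have kk10 : 0 < 1 - kk by rewrite subr_gt0.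
pose V := [set D h | h in [set h : nat -> R | h j = 1]].
have lbV : lbound V (1 - kk).
  move=> _ [h /= hj <-]; apply: le_trans (Dk h); rewrite ler_peMr ?(ltW kk10)//.
  by rewrite -(pw1 q) -hj pw_le_psum.
have V0 : V (D (unit_vec j)) by exists (unit_vec j) => //=; rewrite /unit_vec eqxx.
have infV : has_inf V by split; [exists (D (unit_vec j)) | exists (1 - kk)].
pose k := inf V.
have k0 : 0 < k.
  by apply: lt_le_trans kk10 _; apply: lb_le_inf lbV; case: infV.
have k1 : k <= 1.
  apply: (@le_trans _ _ (D (unit_vec j))); first by apply: ge_inf => //; case: infV.
  by rewrite /D psum_unit_vec// gerBl psum_ge0.
have kD h : k * pw q (h j) <= D h.
  have [hj|hj] := eqVneq (h j) 0.
    rewrite hj pw0// mulr0 (le_trans _ (Dk h))// mulr_ge0 ?psum_ge0//.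
    exact: ltW.
  have : k <= D (fun l => (h j)^-1 * h l).
    by apply: ge_inf; [case: infV | exists (fun l => (h j)^-1 * h l) => //=; rewrite mulVf].
  rewrite /D psumZ (@eq_psum _ _ _ (mx_app a0 m _)
    (fun i => (h j)^-1 * mx_app a0 m h i)) => [|i _]; last exact: mx_appZ.
  rewrite psumZ -mulrBr -/(D h) -(ler_pM2r (pw_gt0 q hj)) => /le_trans; apply.
  by rewrite mulrC mulrA -pwM mulfV// pw1 mul1r.
(* t ^+ 2 / pw q t = pw (2 - q) t *)
have [t [t0 t1 te]] : exists t, [/\ 0 < t, t <= 1 & pw (2 - q) t <= e / 20].
  have e20 : 0 < e / 20 by rewrite divr_gt0.
  have [t t0 tP] := @pw_small R (2 - q) (e / 20) ltac:(lra) e20.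
  exists (Num.min 1 t); rewrite lt_min ltr01 t0 ge_min lexx; split=> //.
  by apply: tP; rewrite ger0_norm ?ge_min ?lexx ?orbT// le_min ler01 ltW.
pose eta := t ^+ 2; have eta0 : 0 < eta by rewrite exprn_gt0.
have [_ [h0 /= h0j <-] h0k] := inf_adherent eta0 infV.
rewrite -/k in h0k.
have [d3 d30 d3P] := @pw_small R q e1 q_gt0 e10.
have [s [v [z [sd svP svz]]]] := entry_kernel q1 k0 k1 d30.
pose b := feed_entry m s v a0 j.
have bm : supported m.+1 b by exact: supported_feed_entry.
have bc : contraction q b.
  apply: (contraction_supported q0 bm) => h; rewrite psum_feed_entry//.
  apply: le_trans (lerD (lexx _) (svP _ _)) _; rewrite psumS.
  have := kD h; rewrite /D; lra.
pose g0 l := if (l < m)%N then h0 l else if l == m then z else 0.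
have g0m : g0 m = z by rewrite /g0 ltnn eqxx.
have g0h i : (i < m)%N -> g0 i = h0 i by rewrite /g0 => ->.
pose g t' l := g0 l + t' * unit_vec j l.
have jm1 : (j < m.+1)%N by rewrite ltnW.
have psum_g0 : psum q m.+1 g0 = psum q m h0 + pw q z.
  by rewrite psumS g0m; congr (_ + _); exact: eq_psum.
have psum_bg0 : psum q m.+1 (mx_app b m.+1 g0) =
    psum q m (mx_app a0 m h0) + (k + pw q z).
  rewrite psum_feed_entry// g0m g0h// h0j mulr1 svz; congr (_ + _).
  by apply: eq_psum => i _; exact: eq_mx_app.
have psum_g t' : psum q m.+1 (g t') = psum q m.+1 g0 + (pw q (1 + t') - 1).
  by rewrite psum_add_unit_vec// g0h// h0j pw1.
have app_g c' t' i : mx_app c' m.+1 (g t') i = mx_app c' m.+1 g0 i + t' * c' i j.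
  by rewrite mx_appD mx_appZ {2}/mx_app sum_unit_vec.
pose tau := eta / (2 * psum q m.+1 g0 + 2 * t ^+ 2).
have B0 : 0 < 2 * psum q m.+1 g0 + 2 * t ^+ 2.
  by rewrite ltr_wpDl// ?mulr_gt0// mulr_ge0// psum_ge0.
have tau0 : 0 < tau by rewrite divr_gt0.
have [d1 d10 d1P] := psum_perturb m.+1 m.+1 q1 tau0.
have e20 : 0 < e / 2 by rewrite divr_gt0.
have [d2 d20 d2P] := psum_const_small m.+1 q_gt0 e20.
pose d := Num.min d1 d2.
have d0 : 0 < d by rewrite lt_min d10.
exists b, m.+1, d; split=> //.
  have -> : e = C * (e1 + e1) by rewrite /e1; field; rewrite gt_eqF.
  apply: (@star_close_trans _ _ _ _ _ _ _ a0) => //; [exact: ltW.. | |].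
    exact: star_closeW (leq_maxl _ _) (lexx _) a_a0.
  apply: star_closeW (leqnn _) (d3P _ sd) _; exact: star_close_feed_entry.
move=> c cc bcd.
have [dd1 dd2] : d <= d1 /\ d <= d2 by rewrite !ge_min !lexx orbT.
have tail N h : psum q N (fun i => mx_app c m.+1 h (m.+1 + i)%N) <=
    psum q m.+1 h - psum q m.+1 (mx_app b m.+1 h) + tau * psum q m.+1 h.
  have := cc (m.+1 + N)%N m.+1 h; rewrite psum_cat.
  have : psum q m.+1 (mx_app b m.+1 h) <=
      psum q m.+1 (mx_app c m.+1 h) + tau * psum q m.+1 h.
    apply: d1P => i l im lm; last exact: lt_le_trans (bcd i l im lm) dd1.
    exact: contraction_entry bc.
  lra.
rewrite [e]splitr; apply: (col_close_tail _ bm bcd jm1) => // [||N].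
- exact: ltW.
- by apply: d2P; rewrite dd2 ltW.
have := psumB N (fun i => mx_app c m.+1 (g t) (m.+1 + i)%N)
  (fun i => mx_app c m.+1 (g (- t)) (m.+1 + i)%N) q1.
rewrite (@eq_psum _ _ _ _ (fun i => 2 * t * c (m.+1 + i)%N j)); last first.
  by move=> i _; rewrite !app_g; ring.
rewrite psumZ pwM -mulrA ler_pM2l ?pw_gt0// => H.
have T1 := tail N (g t); have T2 := tail N (g (- t)).
rewrite !psum_g in T1 T2.
have P := psum_midpoint m.+1 (mx_app b m.+1 g0) (fun i => t * b i j) q1.
rewrite psum_bg0 in P.
rewrite (@eq_psum _ _ _ (fun i => mx_app b m.+1 g0 i + _)
  (mx_app b m.+1 (g t))) in P; last by move=> i _; rewrite app_g.
rewrite (@eq_psum _ _ _ (fun i => mx_app b m.+1 g0 i - _)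
  (mx_app b m.+1 (g (- t)))) in P; last by move=> i _; rewrite app_g mulNr.
have S := pw_second_difference q1 q2 (ltW t0) t1.
have tauE : tau * (2 * psum q m.+1 g0 + 2 * t ^+ 2) = eta.
  by rewrite /tau divfK// gt_eqF.
have : pw q t * psum q N (fun i => c (m.+1 + i)%N j) <= 5 * t ^+ 2.
  apply: le_trans H _.
  have : tau * (psum q m.+1 g0 + (pw q (1 + t) - 1)) +
      tau * (psum q m.+1 g0 + (pw q (1 - t) - 1)) <= eta.
    by rewrite -mulrDr -tauE ler_pM2l//; lra.
  have : D h0 <= k + t ^+ 2 by exact: ltW.
  move: T1 T2 P; rewrite psum_g0 /D /eta; lra.
have -> : t ^+ 2 = pw q t * pw (2 - q) t.
  rewrite /pw gtr0_norm// -powRD; last first.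
    by apply/implyP => _; rewrite gt_eqF.
  by rewrite subrKC (powR_mulrn 2)// ltW.
rewrite mulrCA ler_pM2l ?pw_gt0 ?gt_eqF// => /le_trans; apply; lra.
Qed.

End ColumnLessThanTwo.

(** * Freezing finitely many rows and columns *)

Section Freezing.
Context {R : realType} (p q : R).
Implicit Types (e d : R) (a b c : nat -> nat -> R) (S T : set nat).

Definition close_on S T e b c :=
  (forall j, S j -> col_close p e j b c) /\
  (forall j, T j -> col_close q e j (transp b) (transp c)).

Definition freezable S T := forall a n e, contraction p a -> 0 < e ->
  exists b m d, [/\ contraction p b, supported m b, star_close p q n e a b,
    0 < d & forall c, contraction p c -> entry_close m d b c ->
      close_on S T e b c].

Context (pq : conjugate_exponents p q).
Let p1 : 1 < p. Proof. by case: pq. Qed.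
Let q1 : 1 < q. Proof. by case: pq. Qed.
Let p0 : 0 < p. Proof. exact: lt_trans ltr01 p1. Qed.
Let C := pw p 2 + pw q 2.
Let C0 : 0 < C. Proof. by rewrite ltr_pwDl ?pw_ge0// pw_gt0. Qed.

Lemma close_onW S T e e' b c : e <= e' -> close_on S T e b c ->
  close_on S T e' b c.
Proof.
move=> ee [bcS bcT]; split=> j jS.
  exact: col_closeW ee (bcS j jS).
exact: col_closeW ee (bcT j jS).
Qed.

Lemma close_on_trans S T e b b' c : 0 <= e -> close_on S T e b b' ->
  close_on S T e b c -> close_on S T (C * (e + e)) b' c.
Proof.
move=> e0 [bS bT] [cS cT]; have ee0 : 0 <= e + e by rewrite addr_ge0.
split=> j jS.
  apply: col_closeW (col_close_trans p1 (col_close_sym (bS j jS)) (cS j jS)).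
  by rewrite ler_wpM2r// lerDl pw_ge0.
apply: col_closeW (col_close_trans q1 (col_close_sym (bT j jS)) (cT j jS)).
by rewrite ler_wpM2r// lerDr pw_ge0.
Qed.

(** The second matrix is chosen inside the entrywise neighbourhood of the first
    one, which keeps frozen what the first one froze. *)
Lemma freezableU S T S' T' : freezable S T -> freezable S' T' ->
  freezable (S `|` S') (T `|` T').
Proof.
move=> ST ST' a n e ac e0.
pose e1 := e / (2 * C); have e10 : 0 < e1 by rewrite divr_gt0// mulr_gt0.
have eE : e = C * (e1 + e1) by rewrite /e1; field; rewrite gt_eqF.
have [b [m [d [bc bm ab d0 bd]]]] := ST a n e1 ac e10.
have d20 : 0 < d / 2 by rewrite divr_gt0.
have [e2 e20 e2P] := star_close_entry q m p0 d20.
pose e3 := Num.min e (Num.min e1 e2).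
have e30 : 0 < e3 by rewrite !lt_min e0 e10.
have [e3e e31 e32] : [/\ e3 <= e, e3 <= e1 & e3 <= e2].
  by rewrite !ge_min !lexx !orbT.
have [b' [m' [d' [bc' bm' ab' d0' bd']]]] := ST' b (maxn n m) e3 bc e30.
have bb' : entry_close m (d / 2) b b'.
  by apply: e2P; exact: star_closeW (leq_maxr _ _) e32 ab'.
exists b', (maxn m m'), (Num.min (d / 2) d'); split=> //.
- by move=> i j; rewrite !geq_max => /orP[]/andP[mi m'i]; rewrite bm'// m'i ?orbT.
- rewrite eE; apply: (star_close_trans _ _ (ltW e10) (ltW e10) ab) => //.
  exact: star_closeW (leq_maxl _ _) e31 ab'.
- by rewrite lt_min d20.
move=> c cc b'c.
have [cS' cT'] : close_on S' T' e b' c.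
  apply: close_onW e3e (bd' c cc _) => i j im jm.
  apply: lt_le_trans (b'c i j _ _) _; rewrite ?ge_min ?lexx ?orbT//.
    exact: leq_trans im (leq_maxr _ _).
  exact: leq_trans jm (leq_maxr _ _).
have [cS cT] : close_on S T e b' c.
  rewrite eE; apply: close_on_trans (ltW e10) (bd b' bc' _) (bd c cc _).
    move=> i j im jm; apply: lt_le_trans (bb' i j im jm) _.
    lra.
  move=> i j im jm; rewrite [d]splitr -[_ - _](subrKA (b' i j)).
  rewrite (le_lt_trans (ler_normD _ _))// ltrD//; last exact: bb'.
  apply: lt_le_trans (b'c i j _ _) _; rewrite ?ge_min ?lexx ?orbT//.
    exact: leq_trans im (leq_maxl _ _).
  exact: leq_trans jm (leq_maxl _ _).
by split=> j [|]; [exact: cS|exact: cS'|exact: cT|exact: cT'].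
Qed.

Lemma freezable0 : freezable set0 set0.
Proof.
move=> a n e ac e0.
have [m [k [b [_ /andP[_ k1] bm ab bk]]]] := truncation n pq ac e0.
exists b, m, 1; split=> //.
apply: contraction_supported bm _; first by rewrite gt_eqF.
by move=> h; rewrite (le_trans (bk h))// ler_piMl ?psum_ge0// ltW.
Qed.

Context (cols : frozen_column_dense p q) (rows : frozen_column_dense q p).

Lemma freezable_col j : freezable [set j] set0.
Proof.
move=> a n e ac e0; have [b [m [d [bc bm ab d0 bd]]]] := cols n j ac e0.
by exists b, m, d; split=> // c cc bcd; split=> // _ ->; exact: bd.
Qed.

Lemma freezable_row j : freezable set0 [set j].
Proof.
case: pq => _ _ pqE; have qpE : q^-1 + p^-1 = 1 by rewrite addrC.
move=> a n e /(contraction_transp p1 q1 pqE) ac e0.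
have [b [m [d [bc bm ab d0 bd]]]] := rows n j ac e0.
exists (transp b), m, d; split=> //.
- exact: contraction_transp bc.
- by move=> i l; rewrite orbC; exact: bm.
- exact: star_closeC ab.
move=> c /(contraction_transp p1 q1 pqE) cc bcd; split=> // _ ->.
by apply: bd cc _ => i l im lm; exact: bcd.
Qed.

(** All rows and columns of index less than [n] are frozen at once, at a matrix [b]
    that is strong*-close to [a]; its entrywise neighbourhood then stays
    strong*-close to [a]. *)
Lemma star_close_entry_open a n e : contraction p a -> 0 < e ->
  exists b m d, [/\ contraction p b, supported m b, 0 < d &
    forall c, contraction p c -> entry_close m d b c -> star_close p q n e a c].
Proof.
move=> ac e0.
have frozen : freezable [set j | (j < n)%N] [set j | (j < n)%N].
  elim: n => [|n IH].
    suff -> : [set j | (j < 0)%N] = set0 by exact: freezable0.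
    by apply/seteqP; split.
  suff -> : [set j | (j < n.+1)%N] =
      [set j | (j < n)%N] `|` ([set n] `|` set0).
    apply: freezableU IH _; rewrite {2}setUC.
    by apply: freezableU; [exact: freezable_col | exact: freezable_row].
  rewrite setU0; apply/seteqP; split=> j /= => [|[jn|->]].
  - by rewrite ltnS leq_eqVlt => /predU1P[->|]; [right|left].
  - exact: ltnW.
  - exact: ltnSn.
pose e1 := e / (2 * C); have e10 : 0 < e1 by rewrite divr_gt0// mulr_gt0.
have [b [m [d [bc bm ab d0 bd]]]] := frozen a n e1 ac e10.
exists b, m, d; split=> // c cc /(bd c cc)[cS cT].
have -> : e = C * (e1 + e1) by rewrite /e1; field; rewrite gt_eqF.
apply: (star_close_trans _ _ (ltW e10) (ltW e10) ab) => // j jn.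
by split; [exact: cS | exact: cT].
Qed.

End Freezing.

(** * The sequence space *)

Section SequenceSpace.
Context {R : realType} (p : R) (p1 : (1 <= p%:E)%E).
Implicit Types (x y : ell p1) (c : R).

Let p_gt0 : 0 < p.
Proof. by apply: lt_le_trans ltr01 _; rewrite -lee_fin. Qed.
Let p_neq0 : p != 0. Proof. by rewrite gt_eqF. Qed.

Lemma ell_addE x y k : (x + y) k = x k + y k.
Proof. by []. Qed.

Lemma ell_scaleE c x k : (c *: x) k = c * x k.
Proof. by []. Qed.

Lemma ell_oppE x k : (- x) k = - x k.
Proof. by []. Qed.

Lemma ell_sumE (I : Type) (r : seq I) (P : pred I) (F : I -> ell p1) k :
  (\sum_(i <- r | P i) F i) k = \sum_(i <- r | P i) F i k.
Proof. by elim/big_rec2 : _ => // i y1 y2 _ <-. Qed.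

Lemma ell_nneseries x :
  (\sum_(k <oo) (`|x k| `^ p)%:E = (pw p `|x|)%:E)%E.
Proof.
rewrite /pw normr_id -poweR_EFin ell_normE -poweRrM mulVf// poweRe1//.
by apply: nneseries_ge0 => k _ _; rewrite lee_fin powR_ge0.
Qed.

Lemma ler_ell_norm x c : 0 <= c ->
  `|x| <= c <-> forall n, psum p n x <= pw p c.
Proof.
move=> c0; split=> [xc n|xc].
  apply: le_trans (_ : pw p `|x| <= _); last first.
    by apply: ler_pw; [exact: ltW | rewrite normr_id ger0_norm].
  rewrite -lee_fin -ell_nneseries /psum -sumEFin; apply: nneseries_lim_ge.
  by move=> k _ _; rewrite lee_fin powR_ge0.
rewrite -[X in X <= _]normr_id -[X in _ <= X](ger0_norm c0) -(ler_pwE _ _ p_gt0).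
rewrite -lee_fin -ell_nneseries; apply: lime_le.
  by apply: is_cvg_nneseries => k _ _; rewrite lee_fin powR_ge0.
by near=> n; rewrite sumEFin lee_fin; exact: xc.
Unshelve. all: by end_near. Qed.

Lemma psum_ell_le x n : psum p n x <= pw p `|x|.
Proof. by have /(ler_ell_norm x (normr_ge0 x)) := lexx `|x|; exact. Qed.

Lemma ell_coord_le x k : `|x k| <= `|x|.
Proof.
rewrite -[leRHS]normr_id -(ler_pwE _ _ p_gt0).
exact: le_trans (pw_le_psum p x (ltnSn k)) (psum_ell_le x k.+1).
Qed.

Lemma unit_vec_Lfun k :
  (unit_vec k : nat -> R) \in Lfun (@counting nat R) p%:E.
Proof.
apply/andP; split; rewrite inE//= /finite_norm Lnorm_counting//.
apply: poweR_lty.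
apply: le_lt_trans (ltry 1); apply: lime_le.
  by apply: is_cvg_nneseries => i _ _; exact: poweR_ge0.
near=> n; rewrite (eq_bigr (fun i => (pw p (unit_vec k i))%:E))//.
rewrite sumEFin lee_fin -/(psum p n _).
have kn : (k < n)%N by near: n; exists k.+1.
by rewrite psum_unit_vec.
Unshelve. all: by end_near. Qed.

Definition ell_basis k : ell p1 := Lfun_Sub p1 (unit_vec_Lfun k).

Lemma ell_basisE k i : ell_basis k i = unit_vec k i.
Proof. by []. Qed.

Definition ell_trunc n x : ell p1 := \sum_(0 <= k < n) x k *: ell_basis k.

Lemma ell_sum_basisE n (h : nat -> R) i :
  (\sum_(0 <= k < n) h k *: ell_basis k : ell p1) i = if (i < n)%N then h i else 0.
Proof.
rewrite ell_sumE; under eq_bigr do rewrite ell_scaleE ell_basisE.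
case: ltnP => ni.
  rewrite -(@sum_unit_vec _ h i n ni); apply: eq_bigr => k _.
  by rewrite /unit_vec eq_sym.
rewrite big_nat_cond big1// => k /andP[/andP[_ kn] _].
by rewrite /unit_vec gtn_eqF ?mulr0// (leq_trans kn ni).
Qed.

Lemma norm_sum_basis n (h : nat -> R) :
  pw p `|\sum_(0 <= k < n) h k *: ell_basis k : ell p1| = psum p n h.
Proof.
apply/eqP; rewrite eq_le; apply/andP; split; last first.
  apply: le_trans (psum_ell_le _ n); apply: ler_psum => i ilt.
  by rewrite ell_sum_basisE ilt.
have [c c0 cE] : exists2 c, 0 <= c & pw p c = psum p n h.
  exists (psum p n h `^ p^-1); first exact: powR_ge0.
  rewrite /pw ger0_norm ?powR_ge0// -powRrM mulVf// powRr1//; exact: psum_ge0.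
rewrite -cE; apply: ler_pw; first exact: ltW.
rewrite normr_id (ger0_norm c0); apply/(ler_ell_norm _ c0) => m; rewrite cE.
apply: le_trans (psum_le p _ (leq_addl n m)) _; rewrite psum_cat.
rewrite [X in _ + X]big1 ?addr0 => [|i _]; last first.
  by rewrite ell_sum_basisE ltnNge leq_addr/= pw0.
by apply: ler_psum => i ilt; rewrite ell_sum_basisE ilt.
Qed.

Lemma ell_trunc_close x e : 0 < e -> exists n, `|x - ell_trunc n x| <= e.
Proof.
move=> e0; have [n nP] := psum_tail (pw_gt0 p (lt0r_neq0 e0)) (psum_ell_le x).
exists n; apply/(ler_ell_norm _ (ltW e0)) => m.
apply: le_trans (psum_le p _ (leq_addl n m)) _; rewrite psum_cat.
rewrite [X in X + _]big_nat_cond [X in X + _]big1 ?add0r; last first.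
  move=> i /andP[/andP[_ ilt] _].
  by rewrite ell_addE ell_oppE ell_sum_basisE ilt subrr pw0.
apply: le_trans (nP n (leqnn n) m); apply: ler_psum => i _.
by rewrite -[X in pw p X <= _]/((x - ell_trunc n x) (n + i)%N) ell_addE ell_oppE ell_sum_basisE ltnNge leq_addr/= subr0.
Qed.

End SequenceSpace.

(** * Operators on the sequence space and their matrices *)

Section DualRows.
Context {R : realType} (p q : R) (pq : conjugate_exponents p q).

Let p1 : 1 < p. Proof. by case: pq. Qed.
Let q1 : 1 < q. Proof. by case: pq. Qed.
Let pqE : p^-1 + q^-1 = 1. Proof. by case: pq. Qed.
Let qpE : q^-1 + p^-1 = 1. Proof. by rewrite addrC. Qed.

Let row_mx0 (r : nat -> R) : nat -> nat -> R := fun i j => if i == 0%N then r j else 0.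

(** Both directions are [contraction_transp], for the matrix whose only nonzero row
    is [r]. *)
Lemma row_dualP (r : nat -> R) :
  (forall n h, pw p (\sum_(0 <= j < n) r j * h j) <= psum p n h) <->
  (forall n, psum q n r <= 1).
Proof.
have q0 : q != 0 by rewrite gt_eqF// (lt_trans ltr01).
have p0 : p != 0 by rewrite gt_eqF// (lt_trans ltr01).
split=> [rp n|rq n h].
  suff /(contraction_transp p1 q1 pqE) /(contraction_col 0 n q0) :
    contraction p (row_mx0 r) by [].
  case=> [|m] k h; first by rewrite /psum big_geq// psum_ge0.
  rewrite psum_recl [X in _ + X]big1 ?addr0 => [|i _]; first exact: rp.
  by rewrite /mx_app big1 ?pw0// => l _; rewrite mul0r.
suff /(contraction_transp q1 p1 qpE) /(_ 1%N n h) :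
    contraction q (transp (row_mx0 r)).
  by rewrite psum1.
move=> m [|k] g.
  rewrite /psum [leRHS]big_geq// big1// => i _.
  by rewrite /mx_app big_geq// pw0.
rewrite (@eq_psum _ _ _ _ (fun i => g 0%N * r i)) => [|i _]; last first.
  rewrite /mx_app big_nat_recl//= big1 ?addr0; first by rewrite mulrC.
  by move=> l _; rewrite mul0r.
rewrite psumZ psum_recl -[leLHS]addr0 lerD ?psum_ge0//.
by rewrite ler_piMr ?pw_ge0.
Qed.

End DualRows.

Section Operators.
Context {R : realType} (p q : R) (pq : conjugate_exponents p q).
Context (p_ge1 : (1 <= p%:E)%E).
Local Notation X := (ell p_ge1).
Local Notation e_ := (ell_basis p_ge1).
Implicit Types (x y : X) (f g : dual X) (S T : bop X X) (d e : R) (h : nat -> R).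

Let p1 : 1 < p. Proof. by case: pq. Qed.
Let q1 : 1 < q. Proof. by case: pq. Qed.
Let p_gt0 : 0 < p.
Proof. by apply: lt_le_trans ltr01 _; rewrite -lee_fin. Qed.
Let q_gt0 : 0 < q. Proof. exact: lt_trans ltr01 q1. Qed.

Lemma coord_subproof k : ((fun x => x k) : X -> R^o) \in @bounded_operator R X R^o.
Proof.
apply/bounded_operatorP; split=> [a x y|]; first by rewrite ell_addE ell_scaleE.
by exists 1 => x; rewrite mul1r ell_coord_le.
Qed.

Definition coord k : dual X := Bop (coord_subproof k).

Lemma dual_sumE (I : Type) (r : seq I) (P : pred I) (F : I -> dual X) x :
  (\sum_(i <- r | P i) F i) x = \sum_(i <- r | P i) F i x.
Proof. by elim/big_rec2 : _ => // i y1 y2 _ <-. Qed.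

Lemma dual_sum_basis f n h :
  f (\sum_(0 <= j < n) h j *: e_ j) = \sum_(0 <= j < n) f (e_ j) * h j.
Proof.
rewrite linear_sum; apply: eq_bigr => j _.
by rewrite linearZ/= mulrC.
Qed.

Lemma dual_norm_le f d : 0 < d -> (forall n, psum q n (fun j => f (e_ j)) <= pw q d) ->
  forall x, `|f x| <= d * `|x|.
Proof.
move=> d0 fd x.
have fn n : `|f (ell_trunc n x)| <= d * `|x|.
  have r1 m : psum q m (fun j => d^-1 * f (e_ j)) <= 1.
    rewrite psumZ; apply: le_trans (_ : pw q d^-1 * pw q d <= _).
      by rewrite ler_wpM2l ?pw_ge0.
    by rewrite -pwM mulVf ?pw1// gt_eqF.
  have /(row_dualP pq)/(_ n x) := r1.
  have -> : \sum_(0 <= j < n) d^-1 * f (e_ j) * x j = d^-1 * f (ell_trunc n x).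
    by rewrite dual_sum_basis mulr_sumr; apply: eq_bigr => j _; rewrite mulrA.
  move=> /le_trans /(_ (psum_ell_le x n)).
  rewrite ler_pwE// normr_id normrM gtr0_norm ?invr_gt0//.
  by rewrite ler_pdivrMl.
apply/ler_addgt0Pr => e e0.
have M0 : 0 < opnorm f + 1 by rewrite ltr_wpDl ?opnorm_ge0.
have [n xn] := @ell_trunc_close _ _ _ x (e / (opnorm f + 1)) (divr_gt0 e0 M0).
rewrite -[x in f x](subrK (ell_trunc n x)) linearD/= addrC.
rewrite (le_trans (ler_normD _ _))// lerD//.
rewrite (le_trans (opnormP f _))//.
apply: le_trans (_ : (opnorm f + 1) * (e / (opnorm f + 1)) <= _).
  by rewrite ler_pM ?opnorm_ge0// lerDl.
by rewrite mulrC divfK// gt_eqF.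
Qed.

Lemma dual_coef_bound f : forall n,
  psum q n (fun j => f (e_ j)) <= pw q (opnorm f + 1).
Proof.
have M0 : 0 < opnorm f + 1 by rewrite ltr_wpDl ?opnorm_ge0.
pose M := opnorm f + 1.
have /(row_dualP pq) H : forall n h,
    pw p (\sum_(0 <= j < n) M^-1 * f (e_ j) * h j) <= psum p n h.
  move=> n h; rewrite -(norm_sum_basis p_ge1).
  under eq_bigr do rewrite -mulrA.
  rewrite -mulr_sumr -dual_sum_basis; apply: ler_pw; first exact: ltW.
  rewrite normr_id normrM gtr0_norm ?invr_gt0// mulrC ler_pdivrMr//.
  rewrite (le_trans (opnormP _ _))// mulrC ler_wpM2l// lerDl//.
move=> n; have := H n; rewrite psumZ -(ler_pM2l (pw_gt0 q (lt0r_neq0 M0))).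
by rewrite mulrA -pwM mulfV ?gt_eqF// pw1 mul1r mulr1.
Qed.

(** The coefficients of [f] are [q]-summable, with [q] finite, so their tails are
    small. *)
Lemma dual_tail f e : 0 < e -> exists n, forall x,
  `|f x - \sum_(0 <= k < n) f (e_ k) * x k| <= e * `|x|.
Proof.
move=> e0.
have [n nP] := psum_tail (pw_gt0 q (lt0r_neq0 e0)) (dual_coef_bound f).
exists n => x; pose g : dual X := f - \sum_(0 <= k < n) f (e_ k) *: coord k.
have gE y : g y = f y - \sum_(0 <= k < n) f (e_ k) * y k.
  by rewrite -[LHS]/(f y - (\sum_(0 <= k < n) f (e_ k) *: coord k) y) dual_sumE.
rewrite -gE; apply: dual_norm_le => // m.
apply: le_trans (psum_le q _ (leq_addl n m)) _; rewrite psum_cat.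
have ge j : g (e_ j) = if (j < n)%N then 0 else f (e_ j).
  rewrite gE; under eq_bigr do rewrite ell_basisE.
  case: ltnP => jn.
    by rewrite (@sum_unit_vec _ (fun k => f (e_ k)))// subrr.
  rewrite big_nat_cond big1 ?subr0// => k /andP[/andP[_ kn] _].
  by rewrite /unit_vec ltn_eqF ?mulr0// (leq_trans kn).
rewrite [X in X + _]big_nat_cond [X in X + _]big1 ?add0r; last first.
  by move=> i /andP[/andP[_ ilt] _]; rewrite ge ilt pw0// gt_eqF.
apply: le_trans (nP n (leqnn n) m); apply: ler_psum => i _.
by rewrite ge ltnNge leq_addr.
Qed.

Definition op_mx T : nat -> nat -> R := fun i j => T (e_ j) i.

Lemma contraction_op_mx T : `|T| <= 1 -> contraction p (op_mx T).
Proof.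
move=> T1 m n h; rewrite -[leRHS](norm_sum_basis p_ge1).
set z := \sum_(0 <= k < n) _.
have -> : psum p m (mx_app (op_mx T) n h) = psum p m (T z).
  apply: eq_psum => i _; rewrite /z linear_sum ell_sumE.
  by apply: eq_bigr => j _; rewrite linearZ -[RHS]/(h j * op_mx T i j) mulrC.
apply: le_trans (psum_ell_le _ _) _; apply: ler_pw; first exact: ltW.
by rewrite !normr_id (le_trans (opnormP T z))// ler_piMl.
Qed.

Section FiniteMatrix.
Context (m : nat) (b : nat -> nat -> R).
Context (bm : supported m b) (bc : contraction p b).

Definition mx_op_fun x : X := \sum_(0 <= i < m) mx_app b m x i *: e_ i.

Lemma mx_op_norm x : `|mx_op_fun x| <= `|x|.
Proof.
rewrite -normr_id -[leRHS]normr_id -(ler_pwE _ _ p_gt0).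
by rewrite norm_sum_basis (le_trans (bc m m x))// psum_ell_le.
Qed.

Lemma mx_op_subproof : mx_op_fun \in @bounded_operator R X X.
Proof.
apply/bounded_operatorP; split=> [a x y|]; last first.
  by exists 1 => x; rewrite mul1r mx_op_norm.
rewrite /mx_op_fun scaler_sumr -big_split/=; apply: eq_bigr => i _.
rewrite scalerA -scalerDl; congr (_ *: _).
by rewrite -mx_appZ -mx_appD; exact: eq_mx_app.
Qed.

Definition mx_op : bop X X := Bop mx_op_subproof.

Lemma norm_mx_op : `|mx_op| <= 1.
Proof. by apply: opnorm_le => x; apply: le_trans; exact: mx_op_norm. Qed.

Lemma op_mxK : op_mx mx_op = b.
Proof.
apply/funext => i; apply/funext => j.
rewrite /op_mx /= /mx_op_fun ell_sum_basisE; case: ltnP => im; last first.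
  by rewrite bm// im.
rewrite /mx_app; under eq_bigr do rewrite ell_basisE.
case: (ltnP j m) => jm; first by rewrite sum_unit_vec.
rewrite bm ?jm ?orbT// big_nat_cond big1// => k /andP[/andP[_ km] _].
by rewrite /unit_vec ltn_eqF ?mulr0// (leq_trans km jm).
Qed.

End FiniteMatrix.

Lemma entry_close_nbhs_WOT T m d : 0 < d ->
  nbhs (T : WOT X) [set S | entry_close m d (op_mx T) (op_mx S)].
Proof.
move=> d0.
have /cvg_WOT TT : nbhs (T : WOT X) --> (T : WOT X) by [].
have near_entry (i j : 'I_m) :
    nbhs (T : WOT X) [set S | `|op_mx S i j - op_mx T i j| < d].
  have /cvg_weak /(_ (coord i)) /cvgr_dist_lt /(_ d d0) := TT (e_ j).
  rewrite -[X in X -> _]/(nbhs (T : WOT X) [set S | `|op_mx T i j - op_mx S i j| < d]).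
  by apply: filterS => S /=; rewrite distrC.
have : nbhs (T : WOT X) [set S | forall ij : 'I_m * 'I_m,
    `|op_mx S ij.1 ij.2 - op_mx T ij.1 ij.2| < d].
  apply: (@filter_forall _ _ (fun (ij : 'I_m * 'I_m) (S : bop X X) =>
    `|op_mx S ij.1 ij.2 - op_mx T ij.1 ij.2| < d) _ (nbhs_filter (T : WOT X))).
  by move=> [i j]; exact: near_entry.
by apply: filterS => S TS i j im jm; exact: (TS (Ordinal im, Ordinal jm)).
Qed.

(** On the unit ball, convergence need only be tested on the basis vectors and on
    the coordinate functionals, since these span dense subspaces of the space and
    of its dual. *)
Lemma nbhs_SOTstar_star_close T U : `|T| <= 1 -> nbhs (T : SOTstar X) U ->
  exists n e, 0 < e /\ forall S, `|S| <= 1 ->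
    star_close p q n e (op_mx T) (op_mx S) -> U S.
Proof.
move=> T1; pose F : set_system (bop X X) := [set P | exists n e, 0 < e /\
  forall S, `|S| <= 1 -> star_close p q n e (op_mx T) (op_mx S) -> P S].
have FF : Filter F.
  split.
  - by exists 0%N, 1.
  - move=> P Q [n [e [e0 nP]]] [n' [e' [e'0 nQ]]].
    exists (maxn n n'), (Num.min e e'); split; first by rewrite lt_min e0.
    move=> S S1 TS; split.
      by apply: nP => //; apply: star_closeW TS; rewrite ?leq_maxl// ge_min lexx.
    by apply: nQ => //; apply: star_closeW TS; rewrite ?leq_maxr// ge_min lexx orbT.
  - move=> P Q PQ [n [e [e0 nP]]]; exists n, e; split=> // S S1 TS.
    by apply: PQ; exact: nP.
suff : F --> (T : SOTstar X) by exact.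
apply/cvg_SOTstar; split=> [x|f]; apply/cvgrPdist_le => eps eps0.
- have eps4 : 0 < eps / 4 by rewrite divr_gt0.
  have [n xn] := ell_trunc_close x eps4.
  pose A := \sum_(0 <= k < n) `|x k|.
  have A0 : 0 <= A by exact: sumr_ge0.
  pose d := eps / 2 / (A + 1).
  have d0 : 0 < d by rewrite !divr_gt0// ltr_wpDl.
  exists n, (pw p d); split; first by rewrite pw_gt0// gt_eqF.
  move=> S S1 TS.
  have TSe k : (k < n)%N -> `|T (e_ k) - S (e_ k)| <= d.
    move=> kn; rewrite distrC; apply/(ler_ell_norm _ (ltW d0)) => m.
    have [+ _] := TS k kn; exact.
  have splitx (V : bop X X) : V x = V (x - ell_trunc n x) + V (ell_trunc n x).
    by rewrite -linearD subrK.
  rewrite (splitx T) (splitx S) opprD addrACA.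
  rewrite (le_trans (ler_normD _ _))// [eps]splitr lerD//.
    rewrite (le_trans (ler_normB _ _))// [_ / 2]splitr.
    rewrite -mulrA -invfM -natrM lerD//.
      by rewrite (le_trans (opnormP T _))// (le_trans _ xn)// ler_piMl.
    by rewrite (le_trans (opnormP S _))// (le_trans _ xn)// ler_piMl.
  rewrite /ell_trunc !linear_sum -big_split/= (le_trans (ler_norm_sum _ _ _))//.
  apply: le_trans (_ : A * d <= _); last first.
    by rewrite /d mulrA ler_pdivrMr ?ltr_wpDl// mulrC ler_pM2l ?divr_gt0// lerDl.
  rewrite /A mulr_suml; apply: ler_sum_nat => k /andP[_ kn].
  by rewrite !linearZ/= -scalerDr normrZ ler_wpM2l// TSe.
- have eps4 : 0 < eps / 4 by rewrite divr_gt0.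
  have [n fn] := dual_tail f eps4.
  pose A := \sum_(0 <= k < n) `|f (e_ k)|.
  have A0 : 0 <= A by exact: sumr_ge0.
  pose d := eps / 2 / (A + 1).
  have d0 : 0 < d by rewrite !divr_gt0// ltr_wpDl.
  exists n, (pw q d); split; first by rewrite pw_gt0// gt_eqF.
  move=> S S1 TS.
  have TSc k x : (k < n)%N -> `|(T x - S x) k| <= d * `|x|.
    move=> kn; rewrite distrC.
    pose g : dual X := adjoint S (coord k) - adjoint T (coord k).
    apply: (@dual_norm_le g d d0) => m.
    have [_ +] := TS k kn; exact.
  apply: opnorm_le => x x1.
  rewrite -[leLHS]/(`|f (T x) - f (S x)|) -linearB/=.
  set z := T x - S x.
  have z2 : `|z| <= 2.
    rewrite (le_trans (ler_normB _ _))// -[2]/(1 + 1) lerD//.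
      by rewrite (le_trans (opnormP T _))// mulr_ile1// opnorm_ge0.
    by rewrite (le_trans (opnormP S _))// mulr_ile1// opnorm_ge0.
  rewrite -(subrK (\sum_(0 <= k < n) f (e_ k) * z k) (f z)).
  rewrite (le_trans (ler_normD _ _))// [eps]splitr lerD//.
    rewrite (le_trans (fn z))// (le_trans (ler_wpM2l (ltW eps4) z2))//.
    lra.
  rewrite (le_trans (ler_norm_sum _ _ _))//.
  apply: le_trans (_ : A * d <= _); last first.
    by rewrite /d mulrA ler_pdivrMr ?ltr_wpDl// mulrC ler_pM2l ?divr_gt0// lerDl.
  rewrite /A mulr_suml; apply: ler_sum_nat => k /andP[_ kn].
  rewrite normrM ler_wpM2l// (le_trans (TSc k x kn))// ler_piMr// ltW//.
Qed.

End Operators.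

(** * Similarity of the topologies *)

Section Similarity.
Context {R : realType} (p q : R) (pq : conjugate_exponents p q).
Context (p1 : (1 <= p%:E)%E).
Context (cols : frozen_column_dense p q) (rows : frozen_column_dense q p).
Local Notation X := (ell p1).

Lemma WOT1_open_in_SOTstar1_open (U : set (B1 X)) :
  @open (Topological.Pack (SOTstar1 X)) U -> U !=set0 ->
  exists W : set (B1 X), [/\ @open (Topological.Pack (WOT1 X)) W,
    W !=set0 & W `<=` U].
Proof.
move=> [V Vop <-] [T VT].
have T1 : `|val T : bop X X| <= 1 := valP T.
have [n [e [e0 TV]]] := nbhs_SOTstar_star_close pq T1
  (open_nbhs_nbhs (conj Vop VT : open_nbhs (val T : SOTstar X) V)).
have [b [m [d [bc bm d0 bd]]]] :=
  star_close_entry_open pq cols rows n (contraction_op_mx T1) e0.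
pose B : B1 X := exist _ (mx_op p1 m bc) (norm_mx_op p1 m bc).
pose N : set (WOT X) := [set S | entry_close m d b (op_mx S)].
exists (val @^-1` (N^° : set (WOT X))); split.
- by exists N^° => //; exact: open_interior.
- exists B; have := entry_close_nbhs_WOT (mx_op p1 m bc) m d0.
  by rewrite op_mxK.
- move=> S /= NS; apply: TV; first exact: (valP S).
  apply: bd; first exact: contraction_op_mx (valP S).
  exact: (interior_subset NS).
Qed.

(** A nonempty [tau2]-open set contains a nonempty WOT-open set, which is
    [tau1]-open. *)
Lemma dense_between (tau1 tau2 : Topological (B1 X)) (D : set (B1 X)) :
  coarser (WOT1 X) tau1 -> coarser tau2 (SOTstar1 X) ->
  @dense (Topological.Pack tau1) D -> @dense (Topological.Pack tau2) D.
Proof.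
move=> WOT_tau1 tau2_SOT D1 U U0 Uop.
have [W [Wop W0 WU]] := WOT1_open_in_SOTstar1_open (tau2_SOT U Uop) U0.
have [S [WS DS]] := D1 W W0 (WOT_tau1 W Wop).
by exists S; split=> //; exact: WU.
Qed.

End Similarity.

Theorem theorem1p3 (R : realType) (p : R) (p1 : (1 <= p%:E)%E)
    (hp : p = 3 \/ p = 3 / 2)
    (tau1 tau2 : Topological (B1 (ell p1))) :
  coarser (WOT1 (ell p1)) tau1 -> coarser tau1 (SOTstar1 (ell p1)) ->
  coarser (WOT1 (ell p1)) tau2 -> coarser tau2 (SOTstar1 (ell p1)) ->
  similar_topologies tau1 tau2.
Proof.
move=> W1 S1 W2 S2.
have three : conjugate_exponents (3 : R) (3 / 2).
  by split; [lra|lra|field].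
have cols : frozen_column_dense (3 : R) (3 / 2) := frozen_column_three three.
have rows : frozen_column_dense (3 / 2 : R) 3.
  apply: frozen_column_lt_two (conjugate_exponentsC three) _; lra.
have [q [pq pcols prows]] : exists q, [/\ conjugate_exponents p q,
    frozen_column_dense p q & frozen_column_dense q p].
  case: hp => ->; [exists (3 / 2) | exists 3] => //.
  by split=> //; exact: conjugate_exponentsC.
by move=> D; split; exact: (dense_between pq).
Qed.
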